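(* There exist simplices of infinite volume in $\mathbb{H}^{2,2}$, but none of them is ideal. For all integers $p\ge 3$ and $q\ge 1$, there exist simplices of infinite volume in $\mathbb{H}^{p,q}$, both ideal and non-ideal.
   Context: Let $p>0$, $q\ge 0$ be integers. Let $\mathbb{R}^{p,q+1}$ be the oriented vector space $\mathbb{R}^{p+q+1}$ endowed with a non-degenerate symmetric bilinear form $\mathbf{b}$ of signature $(p,q+1)$ ($p$ positive, $q+1$ negative directions). The pseudo-hyperbolic space is $\mathbb{H}^{p,q}=\{[x]\in\mathbb{P}(\mathbb{R}^{p,q+1}) \mid \mathbf{b}(x,x)<0\}$. It is the quotient by $\pm\mathrm{id}$ of $\hat{\mathbb{H}}^{p,q}=\{x\in\mathbb{R}^{p,q+1}\mid \mathbf{b}(x,x)=-1\}$, which carries the pseudo-Riemannian metric of signature $(p,q)$ given by restricting $\mathbf{b}$ to $T_x\hat{\mathbb{H}}^{p,q}=x^\perp$; this metric descends to $\mathbb{H}^{p,q}$, and volumes are taken with respect to it. The projective boundary is $\partial\mathbb{H}^{p,q}=\{[x]\in\mathbb{P}(\mathbb{R}^{p,q+1})\mid\mathbf{b}(x,x)=0\}$. A lift of a subset $\Lambda\subset\mathbb{P}(\mathbb{R}^{p,q+1})$ is a map $s$ choosing, for every line $\xi\in\Lambda$, a non-zero vector $s(\xi)\in\xi$. A lift $s$ is positive if the convex hull $\mathrm{Conv}(s(\Lambda))\subset\mathbb{R}^{p,q+1}$ does not contain $0$ and $\mathbf{b}(s(\xi),s(\eta))\le 0$ for all $\xi,\eta\in\Lambda$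 (including $\xi=\eta$). If $s$ is positive, $\mathrm{Conv}(s)$ denotes the interior of the image of $\mathrm{Conv}(s(\Lambda))$ in $\mathbb{P}(\mathbb{R}^{p,q+1})$; it is an open subset of $\mathbb{H}^{p,q}$. A convex hull of $\Lambda$ is any set $\mathrm{Conv}(s)$ with $s$ a positive lift of $\Lambda$. A polytope in $\mathbb{H}^{p,q}$ is a finite subset $\Lambda$ of $\mathbb{P}(\mathbb{R}^{p,q+1})$ admitting a positive lift and such that each of its points is extremal in a convex hull of $\Lambda$ (it is not a non-trivial convex combination of points of $\Lambda$). A simplex of $\mathbb{H}^{p,q}$ is a polytope with $p+q+1$ points (vertices) spanning the vector space $\mathbb{R}^{p,q+1}$. The convex hull of a simplex is unique up to isometry of $\mathbb{H}^{p,q}$; its volume is called the volume of $\Lambda$. A simplex is ideal if all its points lie in $\partial\mathbb{H}^{p,q}$. *)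

(* Defs.v *)
From HB Require Import structures.
From mathcomp Require Import all_boot all_order all_algebra.
From mathcomp Require Import all_classical all_reals all_analysis.

Set Implicit Arguments.
Unset Strict Implicit.
Unset Printing Implicit Defensive.

Import Order.TTheory GRing.Theory Num.Theory.
Import numFieldNormedType.Exports.

Local Open Scope classical_set_scope.
Local Open Scope ring_scope.

(* Lebesgue measure on R^n, carried by n-tuples (the library equips them with
   the product sigma-algebra): the n-fold product of the Lebesgue measure of R,
   transported along R * R^n -> R^(n+1). *)

Section lebesgue_tuple.
Context (R : realType).

Definition pair_cons n (z : measurableTypeR R * n.-tuple R) : n.+1.-tuple R :=
  [tuple of z.1 :: z.2].

Lemma measurable_pair_cons n : measurable_fun setT (@pair_cons n).
Proof. exact: (measurable_cons measurable_fst measurable_snd). Qed.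

Section step.
Context n (mu : {sigma_finite_measure set (n.-tuple R) -> \bar R}).

Definition lebesgue_cons : set (n.+1.-tuple R) -> \bar R :=
  pushforward (lebesgue_measure \x mu)%E (@pair_cons n).

Let lebesgue_cons0 : lebesgue_cons set0 = 0%E.
Proof. by rewrite /lebesgue_cons /pushforward preimage_set0 measure0. Qed.

Let lebesgue_cons_ge0 A : (0 <= lebesgue_cons A)%E.
Proof. by rewrite /lebesgue_cons /pushforward; apply: measure_ge0. Qed.

Let mpre A : measurable A -> measurable (@pair_cons n @^-1` A).
Proof.
by move=> mA; rewrite -[X in measurable X]setTI; apply: measurable_pair_cons.
Qed.

Let lebesgue_cons_sigma_additive : semi_sigma_additive lebesgue_cons.
Proof.
move=> F mF tF mUF; rewrite /lebesgue_cons /pushforward preimage_bigcup.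
apply: measure_semi_sigma_additive.
- by move=> k; exact: mpre.
- apply/trivIsetP => /= i j _ _ ij; rewrite -preimage_setI.
  by move/trivIsetP : tF => /(_ _ _ _ _ ij) ->//; rewrite preimage_set0.
- by rewrite -preimage_bigcup; exact: mpre.
Qed.

HB.instance Definition _ := isMeasure.Build _ _ _ lebesgue_cons
  lebesgue_cons0 lebesgue_cons_ge0 lebesgue_cons_sigma_additive.

Let uncons (t : n.+1.-tuple R) : measurableTypeR R * n.-tuple R :=
  (thead t, [tuple of behead t]).

Let measurable_uncons : measurable_fun setT uncons.
Proof.
apply/measurable_fun_pairP; split.
- exact: (@measurable_tnth _ R n.+1 ord0).
- exact: measurable_behead.
Qed.

Let pair_consK : cancel (@pair_cons n) uncons.
Proof. by case=> x t; congr pair; apply/val_inj. Qed.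

Let unconsK : cancel uncons (@pair_cons n).
Proof. by move=> t; rewrite [RHS]tuple_eta; apply/val_inj. Qed.

Let lebesgue_cons_sigma_finite : sigma_finite setT lebesgue_cons.
Proof.
have /sigma_finiteP[F [TF ndF Foo]] := sigma_finiteT (@lebesgue_measure R).
have /sigma_finiteP[G [TG ndG Goo]] := sigma_finiteT mu.
exists (fun k => uncons @^-1` (F k `*` G k)).
  rewrite -preimage_bigcup (_ : \bigcup_k _ = setT) ?preimage_setT//.
  apply/seteqP; split => // -[x t] _.
  have [i _ Fx] : (\bigcup_i F i) x by rewrite -TF.
  have [j _ Gt] : (\bigcup_i G i) t by rewrite -TG.
  exists (maxn i j) => //; split => /=.
  - by move: x Fx; exact/subsetPset/ndF/leq_maxl.
  - by move: t Gt; exact/subsetPset/ndG/leq_maxr.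
move=> k; have [mF Fk] := Foo k; have [mG Gk] := Goo k; split.
  rewrite -[X in measurable X]setTI; apply: measurable_uncons => //.
  exact: measurableX.
rewrite /lebesgue_cons /pushforward -comp_preimage.
rewrite (_ : uncons \o _ = id) ?preimage_id; last first.
  by apply/funext => z /=; rewrite pair_consK.
by rewrite product_measure1E// lte_mul_pinfty// ge0_fin_numE.
Qed.

HB.instance Definition _ := Measure_isSigmaFinite.Build _ _ _ lebesgue_cons
  lebesgue_cons_sigma_finite.

End step.

Fixpoint lebesgue_tuple n : {sigma_finite_measure set (n.-tuple R) -> \bar R} :=
  match n with
  | 0 => \d_[tuple]
  | m.+1 => lebesgue_cons (lebesgue_tuple m)
  end.

End lebesgue_tuple.

(* The projective space P(R^n): the lines of R^n. *)
Definition proj_space (R : realType) (n : nat) :=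
  {L : {vspace 'rV[R]_n} | \dim L == 1%N}.

HB.instance Definition _ (R : realType) (n : nat) :=
  Choice.on (proj_space R n).

Section proj_topology.
Context (R : realType) (n : nat).
Implicit Types (v : 'rV[R]_n) (xi : proj_space R n) (A : set (proj_space R n)).

(* xi = [v] *)
Definition represents v xi := (v != 0) && (v \in \val xi).

Lemma represents_inj v xi eta : represents v xi -> represents v eta -> xi = eta.
Proof.
move=> /andP[v0 vx] /andP[_ ve]; apply/val_inj.
have line (z : proj_space R n) : v \in \val z -> (<[v]> == \val z)%VS.
  by move=> vz; rewrite eqEdim -memvE vz (eqP (valP z)) dim_vline v0.
by rewrite -(eqP (line _ vx)) -(eqP (line _ ve)).
Qed.

(* the preimage of A under the projection R^n \ {0} -> P(R^n) *)
Definition cone A : set 'rV[R]_n := [set v | exists2 xi, A xi & represents v xi].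

(* the image of C \ {0} under the projection R^n \ {0} -> P(R^n) *)
Definition proj_image (C : set 'rV[R]_n) : set (proj_space R n) :=
  [set xi | exists2 v, C v & represents v xi].

(* The quotient topology of P(R^n); R^n \ {0} being open, "open in R^n \ {0}"
   and "open in R^n" agree for the subsets cone A. *)
Let open_proj A := open (cone A).

Let open_projT : open_proj setT.
Proof.
rewrite /open_proj (_ : cone setT = ~` [set 0]).
  by apply: closed_openC; apply: accessible_closed_set1;
     exact/hausdorff_accessible/norm_hausdorff.
apply/seteqP; split => [v [xi _ /andP[/eqP]]//|v /eqP v0].
have dv : \dim <[v]>%VS == 1%N by rewrite dim_vline v0.
by exists (exist _ <[v]>%VS dv) => //; apply/andP; split=> //; exact: memv_line.
Qed.

Let open_projI : setI_closed open_proj.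
Proof.
move=> A B oA oB; rewrite /open_proj (_ : cone _ = cone A `&` cone B).
  exact: openI.
apply/seteqP; split => [v [xi [Ax Bx] vx]|v [[xi Ax vx] [eta Be ve]]].
  by split; exists xi.
by exists xi => //; split=> //; rewrite (represents_inj vx ve).
Qed.

Let open_proj_bigU (I : Type) (f : I -> set (proj_space R n)) :
  (forall i, open_proj (f i)) -> open_proj (\bigcup_i f i).
Proof.
move=> fo; rewrite /open_proj (_ : cone _ = \bigcup_i cone (f i)).
  by apply: bigcup_open => i _; exact: fo.
apply/seteqP; split => [v [xi [i _ fx] vx]|v [i _ [xi fx vx]]].
  by exists i => //; exists xi.
by exists xi => //; exists i.
Qed.

HB.instance Definition _ := isOpenTopological.Build (proj_space R n)
  open_projT open_projI open_proj_bigU.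

End proj_topology.

Section convex_hull.
Context (R : realType) (n : nat).
Implicit Types (Lambda : set (proj_space R n)) (s : proj_space R n -> 'rV[R]_n).

Definition conv_hull (A : set 'rV[R]_n) : set 'rV[R]_n :=
  smallest (@convex_set R 'rV[R]_n) A.

(* Only the values of s on Lambda are relevant, here and below. *)
Definition is_lift Lambda s := forall xi, Lambda xi -> represents (s xi) xi.

(* Conv(s) *)
Definition lift_hull Lambda s : set (proj_space R n) :=
  interior (proj_image (conv_hull (s @` Lambda))).

(* xi is not a non-trivial convex combination of the points of Lambda, these
   combinations being taken with respect to the vectors chosen by s. *)
Definition extremal Lambda s xi := forall t : proj_space R n -> R,
  (forall eta, Lambda eta -> 0 <= t eta) ->
  \sum_(eta \in Lambda) t eta = 1 ->
  represents (\sum_(eta \in Lambda) t eta *: s eta) xi ->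
  forall eta, Lambda eta -> eta != xi -> t eta = 0.

Definition spanning Lambda := forall W : {vspace 'rV[R]_n},
  (forall xi, Lambda xi -> (\val xi <= W)%VS) -> W = fullv.

End convex_hull.

Section pseudo_hyperbolic.
Context (R : realType) (p q : nat).
Notation V := 'rV[R]_(p + q + 1).
Notation P := (proj_space R (p + q + 1)).
Implicit Types (Lambda A : set P) (s : P -> V).

(* The form b of R^{p,q+1}: x_1^2 + ... + x_p^2 - x_{p+1}^2 - ... - x_{p+q+1}^2 *)
Definition form_mx : 'M[R]_(p + q + 1) :=
  diag_mx (\row_i (if (i < p)%N then 1 else -1)).

Definition form (x y : V) : R := (x *m form_mx *m y^T) 0 0.

Definition Hpq : set P := [set xi | forall v, represents v xi -> form v v < 0].

Definition boundary_Hpq : set P :=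
  [set xi | forall v, represents v xi -> form v v = 0].

(* The volume of H^{p,q}.  The affine chart y |-> [y : 1] covers H^{p,q} up to
   the points of a hyperplane, which form a null set.  On its domain,
   y |-> hyperboloid y is a local section of the double cover of H^{p,q} by
   {x | b(x,x) = -1}, so the Gram matrix of its partial derivatives (the rows
   of its Jacobian matrix) is the matrix of the pseudo-Riemannian metric in the
   chart, and the volume form is sqrt |det g| dy. *)
Definition affine_point (y : 'rV[R]_(p + q)) : V := row_mx y 1%:M.

Definition hyperboloid (y : 'rV[R]_(p + q)) : V :=
  (Num.sqrt (- form (affine_point y) (affine_point y)))^-1 *: affine_point y.

Definition metric_mx (y : 'rV[R]_(p + q)) : 'M[R]_(p + q) :=
  jacobian hyperboloid y *m form_mx *m (jacobian hyperboloid y)^T.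

Definition volume_density (y : 'rV[R]_(p + q)) : R :=
  Num.sqrt `|\det (metric_mx y)|.

Definition row_of_tuple (t : (p + q).-tuple R) : 'rV[R]_(p + q) :=
  \row_i tnth t i.

Definition volume A : \bar R :=
  (\int[lebesgue_tuple R (p + q)]_(t in
      [set t | cone (A `&` Hpq) (affine_point (row_of_tuple t))])
    (volume_density (row_of_tuple t))%:E)%E.

Definition positive_lift Lambda s :=
  [/\ is_lift Lambda s,
      ~ conv_hull (s @` Lambda) 0 &
      forall xi eta, Lambda xi -> Lambda eta -> form (s xi) (s eta) <= 0].

Definition convex_hulls Lambda : set (set P) :=
  [set C | exists2 s, positive_lift Lambda s & C = lift_hull Lambda s].

Definition polytope Lambda :=
  finite_set Lambda /\
  exists2 s, positive_lift Lambda s & forall xi, Lambda xi -> extremal Lambda s xi.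

Definition simplex Lambda :=
  [/\ polytope Lambda, (Lambda #= `I_(p + q + 1))%card & spanning Lambda].

Definition ideal Lambda := Lambda `<=` boundary_Hpq.

(* The volume of a simplex is that of a convex hull of it; any two of them are
   isometric, so one is chosen.  The default set0 is used only when Lambda has
   no positive lift. *)
Definition simplex_volume Lambda : \bar R :=
  volume (xget set0 (convex_hulls Lambda)).

End pseudo_hyperbolic.

Arguments simplex {R} p q Lambda.
Arguments ideal {R} p q Lambda.
Arguments simplex_volume {R} p q Lambda.

(* Main.v *)
From HB Require Import structures.
Require Import Defs.
From mathcomp Require Import all_boot all_order all_algebra fingroup perm action.
From mathcomp Require Import all_classical all_reals all_analysis.
From mathcomp Require Import measurable_realfun.
From mathcomp Require Import ring lra zify.
Import Defs.

(** In the barycentric coordinates t of a simplex with vertices v_i, the volume is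
    comparable to the integral of (sum a_ij t_i t_j)^(-d/2) with
    a_ij = -b(v_i, v_j) >= 0 and d = p + q + 1, so its finiteness depends only on
    which a_ij vanish.

    If an isotropic vertex v_0 is orthogonal to all the other vertices except an
    isotropic v_n, the integral diverges logarithmically at v_0: suitable boxes
    shrinking to v_0 have the same volume. The remaining p + q - 1 vertices may
    then be any basis of R^(p-1,q) with nonpositive products; when p - 1 >= 2 they
    can be taken isotropic, from spacelike separated points of R^(p-2,q-1).

    An ideal simplex of H^(2,2) has a nonnegative 5 x 5 matrix (a_ij) with zero
    diagonal and positive determinant. A positive term of the Leibniz formula comes
    from a 5-cycle, so after relabelling and rescaling
    |t_i t_(i+1)| <= sum a_ij t_i t_j for all i mod 5, and it suffices that the
    region |t_i t_(i+1)| <= 1 of R^5 has finite Lebesgue measure. *)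

Set Implicit Arguments.
Unset Strict Implicit.
Unset Printing Implicit Defensive.

Import Order.TTheory GRing.Theory Num.Theory.
Import numFieldNormedType.Exports.

Local Open Scope classical_set_scope.
Local Open Scope ring_scope.

(** * Lebesgue measure on tuples *)

(** The volume is that of an unspecified hull, so both halves are proved for an arbitrary positive
    lift, and no two hulls are ever compared. The hull is only sandwiched: the cone over it contains
    the vectors whose barycentric coordinates all have one strict sign, and its vectors have
    coordinates of one weak sign. Its measurability is never established; integrals are bounded
    through explicit measurable sets, boxes from below and a linear preimage of the region of the
    5-cycle from above.

    The density is N^(-(n + 1) / 2) with n = p + q and N = -b on the affine chart. Adding a radial
    variable turns the volume, up to a factor, into the Lebesgue measure of the part of the cone
    where -b <= 1. This is why finiteness for H^(2,2) becomes a statement on a subset of R^5.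

    For the ideal example, p >= 3 leaves two positive basis vectors e_1 and e_2 besides the one used
    by v_0 and v_n: e_1 forms an isotropic pair with the negative vector e_p, and e_2 separates the
    remaining points. *)

Section lebesgue_affine.
Context {R : realType}.
Implicit Types (A : set (measurableTypeR R)) (c b : R).

(** Uniqueness of the Lebesgue measure: [|c|] times its pushforward under [x |-> c * x + b] has the
    right value on half-open intervals. *)
Lemma lebesgue_measure_affine c b A : c != 0 -> measurable A ->
  lebesgue_measure [set x | A (c * x + b)] =
  (`|c|^-1%:E * lebesgue_measure A)%E.
Proof.
move=> c0 mA.
pose f : measurableTypeR R -> measurableTypeR R := fun x => c * x + b.
have mf : measurable_fun setT f.
  by apply: measurable_funD => //; exact: measurable_funM.
pose k := NngNum (normr_ge0 c).
pose mu0 := mscale k (pushforward (@lebesgue_measure R) f)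
  : {measure set (measurableTypeR R) -> \bar R}.
pose mu := mu0 mf.
have muE X : mu X = (`|c|%:E * lebesgue_measure [set x | X (c * x + b)%R])%E.
  by [].
have -> : lebesgue_measure A = mu A.
  apply: lebesgue_measure_unique => // X [[x y] _ <-].
  rewrite muE lebesgue_measure_itv /=.
  have [c1|c1|/eqP] := ltgtP 0 c; last by rewrite eq_sym (negbTE c0).
    rewrite (_ : [set _ | _] = `](x - b) / c, (y - b) / c]%classic).
      rewrite lebesgue_measure_itv /= !lte_fin ltr_pM2r ?invr_gt0// ltrD2r.
      case: ifPn => _; last by rewrite mule0.
      rewrite -!EFinB -EFinM; congr EFin.
      by rewrite gtr0_norm//; field.
    apply/seteqP; split => z /=; rewrite !in_itv /= ltr_pdivrMr// ler_pdivlMr//.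
      by rewrite ltrBlDr lerBrDr mulrC.
    by rewrite ltrBlDr lerBrDr [z * c]mulrC.
  rewrite (_ : [set _ | _] = `[(y - b) / c, (x - b) / c[%classic).
    rewrite lebesgue_measure_itv /= !lte_fin ltr_nM2r ?invr_lt0// ltrD2r.
    case: ifPn => _; last by rewrite mule0.
    rewrite -!EFinB -EFinM; congr EFin.
    by rewrite ltr0_norm//; field.
  apply/seteqP; split => z /=; rewrite !in_itv /= ltr_ndivlMr// ler_ndivrMr//.
    by rewrite ltrBlDr lerBrDr [z * c]mulrC andbC.
  by rewrite ltrBlDr lerBrDr [z * c]mulrC andbC.
rewrite muE muleA -EFinM mulVf ?mul1e// normr_eq0//.
Qed.
End lebesgue_affine.

Section lebesgue_tuple_fubini.
Context {R : realType}.
Local Notation leb n := (lebesgue_tuple R n).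

Definition ctuple n (x : R) (t : n.-tuple R) : n.+1.-tuple R :=
  [tuple of x :: t].

Lemma measurable_ctuple n (x : R) : measurable_fun setT (@ctuple n x).
Proof. exact: measurable_cons. Qed.

Lemma measurable_ctuple1 n (t : n.-tuple R) :
  measurable_fun (setT : set (measurableTypeR R)) (fun x => ctuple x t).
Proof. exact: (@measurable_cons _ _ (measurableTypeR R) R id n (cst t)). Qed.

Lemma preimageT_measurable d1 d2 (T1 : measurableType d1) (T2 : measurableType d2)
  (f : T1 -> T2) A : measurable_fun setT f -> measurable A -> measurable (f @^-1` A).
Proof. by move=> mf mA; rewrite -[X in measurable X]setTI; exact: mf. Qed.

Lemma lebesgue_tupleS n (A : set (n.+1.-tuple R)) :
  leb n.+1 A = (\int[lebesgue_measure]_x leb n (ctuple x @^-1` A))%E.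
Proof.
rewrite [LHS]/= /lebesgue_cons /pushforward /product_measure1.
apply: eq_integral => x _ /=; congr (leb n _).
by apply/seteqP; split => t; rewrite /xsection /= inE.
Qed.

(** The definition integrates the measures of the tail sections; uniqueness of the product measure
    gives the other order. *)
Lemma lebesgue_tupleS2 n (A : set (n.+1.-tuple R)) : measurable A ->
  leb n.+1 A =
  (\int[leb n]_t lebesgue_measure [set x | A (ctuple x t)])%E.
Proof.
move=> mA; have mB := preimageT_measurable (@measurable_pair_cons R n) mA.
rewrite [LHS]/= /lebesgue_cons /pushforward.
transitivity ((lebesgue_measure \x^ leb n)%E (@pair_cons R n @^-1` A)).
  apply: product_measure_unique => // X Y mX mY.
  exact: product_measure2E.
rewrite /product_measure2; apply: eq_integral => t _ /=; congr lebesgue_measure.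
by apply/seteqP; split => x; rewrite /ysection /= inE.
Qed.

Lemma measurable_lebesgue_section n (A : set (n.+1.-tuple R)) : measurable A ->
  measurable_fun (setT : set (measurableTypeR R)) (fun x => leb n (ctuple x @^-1` A)).
Proof.
move=> mA; have mB := preimageT_measurable (@measurable_pair_cons R n) mA.
rewrite (_ : (fun _ => _) = leb n \o xsection (@pair_cons R n @^-1` A)).
  exact: measurable_fun_xsection.
apply/funext => x /=; congr (leb n _).
by apply/seteqP; split => t; rewrite /xsection /= inE.
Qed.

Lemma measurable_lebesgue_section2 n (A : set (n.+1.-tuple R)) : measurable A ->
  measurable_fun setT (fun t : n.-tuple R => lebesgue_measure [set x | A (ctuple x t)]).
Proof.
move=> mA; have mB := preimageT_measurable (@measurable_pair_cons R n) mA.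
rewrite (_ : (fun _ => _) = lebesgue_measure \o ysection (@pair_cons R n @^-1` A)).
  exact: measurable_fun_ysection.
apply/funext => x /=; congr lebesgue_measure.
by apply/seteqP; split => t; rewrite /ysection /= inE.
Qed.

Lemma measurable_box n (B : 'I_n -> set R) : (forall i, measurable (B i)) ->
  measurable [set t : n.-tuple R | forall i, B i (tnth t i)].
Proof.
move=> mB; rewrite (_ : [set _ | _] = \bigcap_(i in setT) ((@tnth n R ^~ i) @^-1` B i)).
  apply: fin_bigcap_measurable => // i _.
  exact: (preimageT_measurable (measurable_tnth i)).
by apply/seteqP; split => [t tB i _|t tB i]; [exact: tB|exact: tB].
Qed.

Lemma lebesgue_box n (B : 'I_n -> set R) : (forall i, measurable (B i)) ->
  leb n [set t | forall i, B i (tnth t i)] =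
  (\prod_(i < n) lebesgue_measure (B i : set (measurableTypeR R)))%E.
Proof.
elim: n B => [|n IH] B mB.
  rewrite big_ord0 /= diracE mem_set// => -[]//.
rewrite lebesgue_tupleS2; last exact: measurable_box.
rewrite big_ord_recl -IH//.
transitivity (\int[leb n]_t (lebesgue_measure (B ord0 : set (measurableTypeR R)) *
   (\1_[set t : n.-tuple R | forall i, B (lift ord0 i) (tnth t i)] t)%:E))%E.
  apply: eq_integral => t _; rewrite indicE.
  case: (boolP (t \in _)) => [/set_mem tB|/negP tB].
    rewrite mule1; congr lebesgue_measure; apply/seteqP; split => [x /(_ ord0)//|x Bx i].
    case: (unliftP ord0 i) => [j ->|->//]; rewrite tnthS; exact: tB.
  rewrite mule0 (_ : [set _ | _] = set0) ?measure0//.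
  apply/seteqP; split=> // x xB; apply: tB; rewrite inE => i /=.
  by have := xB (lift ord0 i); rewrite tnthS.
rewrite ge0_integralZl//.
- have mE := measurable_box (fun i => mB (lift ord0 i)).
  by rewrite integral_indic ?setIT.
- by apply/measurable_EFinP; apply: measurable_indic; have := measurable_box (fun i => mB (lift ord0 i)).
Qed.

(** The exact factor matters, since it has to cancel the weight [r ^+ n] in
    [integral_cone_lt_pinfty]. The tail is scaled by induction and the head by
    [lebesgue_measure_affine], each in its own order of integration. *)
Lemma lebesgue_scale n (r : R) (A : set (n.-tuple R)) : 0 < r -> measurable A ->
  leb n ((map_tuple (fun x => r * x)) @^-1` A) =
  ((r ^- n)%:E * leb n A)%E.
Proof.
move=> r0; elim: n A => [|n IH] A mA.
  rewrite expr0 invr1 mul1e; congr (leb 0 _); apply/seteqP.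
  by split => t /=; rewrite [map_tuple _ _]tuple0 [t]tuple0.
have mmap m : measurable_fun setT (map_tuple (n:=m) (fun x : R => r * x)).
  apply/measurable_fun_tnthP => i.
  rewrite (_ : _ \o _ = ( *%R r) \o (fun t : m.-tuple R => tnth t i)); last first.
    by apply/funext => t /=; rewrite tnth_map.
  by apply: measurableT_comp => //; exact: measurable_tnth.
rewrite lebesgue_tupleS.
transitivity (\int[lebesgue_measure]_x ((r ^- n)%:E * leb n (ctuple (r * x)%R @^-1` A)))%E.
  apply: eq_integral => x _; rewrite -IH; last first.
    exact: preimageT_measurable (measurable_ctuple (r * x)) mA.
  congr (leb n _); apply/seteqP.
  by split => t /=; rewrite (_ : map_tuple _ _ = ctuple (r * x) (map_tuple (fun x => r * x) t))//;
    apply/val_inj.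
pose A' : set (n.+1.-tuple R) := [set t | A (ctuple (r * thead t) [tuple of behead t])].
have mA' : measurable A'.
  pose g (t : n.+1.-tuple R) := ctuple (r * thead t) [tuple of behead t].
  have mg : measurable_fun setT g.
    apply: measurable_cons; last exact: measurable_behead.
    apply: measurable_funM => //; exact: (@measurable_tnth _ R n.+1 ord0).
  exact: (preimageT_measurable mg).
have A'E x : ctuple (r * x) @^-1` A = ctuple x @^-1` A'.
  by apply/seteqP; split => t; rewrite /A' /= theadE (_ : [tuple of _] = t)//; apply/val_inj.
under eq_integral do rewrite A'E.
rewrite ge0_integralZl//; last 2 first.
- exact: measurable_lebesgue_section.
- by rewrite lee_fin invr_ge0 exprn_ge0// ltW.
rewrite -lebesgue_tupleS lebesgue_tupleS2//.
transitivity ((r ^- n)%:E * \int[leb n]_t ((r^-1)%:E * lebesgue_measure [set x | A (ctuple x t)]))%E.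
  congr (_ * _)%E; apply: eq_integral => t _.
  have := @lebesgue_measure_affine R r 0 _ (lt0r_neq0 r0)
    (preimageT_measurable (measurable_ctuple1 t) mA).
  rewrite (gtr0_norm r0) /= => <-; congr lebesgue_measure.
  by apply/seteqP; split => x; rewrite /A' /= theadE addr0 (_ : [tuple of _] = t)//; apply/val_inj.
rewrite ge0_integralZl//; last 2 first.
- exact: measurable_lebesgue_section2.
- by rewrite lee_fin invr_ge0 ltW.
by rewrite -lebesgue_tupleS2// muleA -EFinM -invfM -exprSr.
Qed.

End lebesgue_tuple_fubini.

(** * Linear changes of variables *)

Section dominated_maps.
Context {R : realType}.
Local Notation leb n := (lebesgue_tuple R n).

(** An inequality is enough to transport finiteness and is stable under composition, so no
    determinant has to be tracked. *)
Definition dominated n (C : R) (f : n.-tuple R -> n.-tuple R) :=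
  [/\ 0 <= C, measurable_fun setT f &
    forall A, measurable A -> (leb n (f @^-1` A) <= C%:E * leb n A)%E].

Lemma dominated_comp n C D (f g : n.-tuple R -> n.-tuple R) :
  dominated C f -> dominated D g -> dominated (C * D) (g \o f).
Proof.
move=> [C0 mf fC] [D0 mg gD]; split; first exact: mulr_ge0.
  exact: measurableT_comp.
move=> A mA; rewrite comp_preimage EFinM -muleA.
have mB := preimageT_measurable mg mA.
by rewrite (le_trans (fC _ mB))// lee_wpmul2l ?lee_fin//; exact: gD.
Qed.

(** Integrating over the head first makes [h] a constant translation in each section, without effect
    on the factor. *)
Lemma dominated_head n (c : R) (h : n.-tuple R -> R) : c != 0 ->
  measurable_fun setT h ->
  dominated (`|c|^-1) (fun t : n.+1.-tuple R =>
    ctuple (c * thead t + h [tuple of behead t]) [tuple of behead t]).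
Proof.
move=> c0 mh; set f := (X in dominated _ X).
have mf : measurable_fun setT f.
  apply: measurable_cons; last exact: measurable_behead.
  apply: measurable_funD.
    apply: measurable_funM => //; exact: (@measurable_tnth _ R n.+1 ord0).
  by apply: measurableT_comp => //; exact: measurable_behead.
split=> // A mA; rewrite !lebesgue_tupleS2//; last exact: preimageT_measurable mf mA.
rewrite -ge0_integralZl//; last exact: measurable_lebesgue_section2.
rewrite le_eqVlt; apply/orP; left; apply/eqP/eq_integral => t _.
rewrite -(lebesgue_measure_affine (h t) c0); last first.
  exact: (preimageT_measurable (measurable_ctuple1 t)).
congr lebesgue_measure; apply/seteqP; split => x /=;
  by rewrite /f theadE (_ : [tuple of _] = t)//; apply/val_inj.
Qed.

Lemma dominated_tail n (C : R) (f : R -> n.-tuple R -> n.-tuple R) :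
  (forall x, dominated C (f x)) ->
  let g := (fun t : n.+1.-tuple R =>
    ctuple (thead t) (f (thead t) [tuple of behead t])) in
  measurable_fun setT g -> dominated C g.
Proof.
move=> fC g mg; have [C0 _ _] := fC 0; split=> // A mA.
have mgA := preimageT_measurable mg mA.
rewrite !lebesgue_tupleS -ge0_integralZl//; last exact: measurable_lebesgue_section.
apply: ge0_le_integral => //.
- exact: measurable_lebesgue_section.
- by apply: measurable_funeM; exact: measurable_lebesgue_section.
move=> x _; have [_ _ /(_ (ctuple x @^-1` A))] := fC x.
rewrite (_ : _ @^-1` (g @^-1` A) = f x @^-1` (ctuple x @^-1` A)).
  apply; exact: (preimageT_measurable (measurable_ctuple x)).
by apply/seteqP; split => t /=;
  rewrite /g theadE (_ : [tuple of _] = t)//; apply/val_inj.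
Qed.

Definition trow n (t : n.-tuple R) : 'rV[R]_n := \row_i tnth t i.
Definition rowt n (v : 'rV[R]_n) : n.-tuple R := [tuple v 0 i | i < n].

Lemma trowK n : cancel (@trow n) (@rowt n).
Proof. by move=> t; apply/eq_from_tnth => i; rewrite tnth_mktuple mxE. Qed.

Lemma rowtK n : cancel (@rowt n) (@trow n).
Proof. by move=> t; apply/rowP => i; rewrite mxE tnth_mktuple. Qed.

Definition linT n m (M : 'M[R]_(n, m)) (t : n.-tuple R) : m.-tuple R :=
  rowt (trow t *m M).

Lemma linT_mul n m k (M : 'M[R]_(n, m)) (N : 'M[R]_(m, k)) :
  linT (M *m N) = linT N \o linT M.
Proof. by apply/funext => t; rewrite /linT /= rowtK mulmxA. Qed.

Lemma measurable_mul_trow n (w : 'cV[R]_n) :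
  measurable_fun setT (fun t => (trow t *m w) 0 0).
Proof.
rewrite (_ : (fun _ => _) = (fun t => \sum_(j < n) tnth t j * w j 0)).
  apply: measurable_sum => j; apply: measurable_funM => //.
  exact: (@measurable_tnth _ R n j).
by apply/funext => t; rewrite mxE; apply: eq_bigr => j _; rewrite mxE.
Qed.

Lemma measurable_linT n m (M : 'M[R]_(n, m)) : measurable_fun setT (linT M).
Proof.
apply/measurable_fun_tnthP => i.
rewrite (_ : _ \o _ = fun t => (trow t *m col i M) 0 0).
  exact: measurable_mul_trow.
apply/funext => t /=; rewrite tnth_mktuple !mxE.
by apply: eq_bigr => j _; rewrite !mxE.
Qed.

Lemma tnth_behead_lift n (t : n.+1.-tuple R) (i : 'I_n) :
  tnth [tuple of behead t] i = tnth t (lift ord0 i).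
Proof.
by case/tupleP: t => x t; rewrite tnthS; congr tnth; apply/val_inj.
Qed.

Lemma dominated_translate n (v : 'rV[R]_n) :
  dominated 1 (fun t => rowt (trow t + v)).
Proof.
have mtr k (w : 'rV[R]_k) : measurable_fun setT (fun t => rowt (trow t + w)).
  apply/measurable_fun_tnthP => i.
  rewrite (_ : _ \o _ = fun t => tnth t i + w 0 i).
    apply: measurable_funD => //; exact: (@measurable_tnth _ R k i).
  by apply/funext => t /=; rewrite tnth_mktuple !mxE.
elim: n v => [|n IH] v.
  split => // A mA; rewrite mul1e (_ : _ @^-1` A = A)//.
  by apply/seteqP; split => t /=; rewrite (tuple0 (rowt _)) (tuple0 t).
pose h (t : n.+1.-tuple R) : n.+1.-tuple R :=
  ctuple (1 * thead t + v 0 ord0) [tuple of behead t].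
pose w : 'rV[R]_n := \row_i v 0 (lift ord0 i).
pose g (t : n.+1.-tuple R) := ctuple (thead t) (rowt (trow [tuple of behead t] + w)).
have -> : (fun t => rowt (trow t + v)) = g \o h.
  apply/funext => t; apply/eq_from_tnth => i; rewrite tnth_mktuple /g /= !mxE.
  have [j ->|->] := unliftP ord0 i; rewrite ?tnthS ?tnth0 ?theadE ?mul1r//.
    by rewrite tnth_mktuple !mxE tnth_behead_lift tnthS tnth_behead_lift.
rewrite -[X in dominated X]mulr1; apply: dominated_comp.
  have := @dominated_head n 1 (cst (v 0 ord0)) (oner_neq0 _) (measurable_cst _).
  by rewrite normr1 invr1.
apply: (@dominated_tail n 1 (fun=> fun t => rowt (trow t + w))) => //.
apply: measurable_cons; first exact: (@measurable_tnth _ R n.+1 ord0).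
apply: (measurableT_comp (mtr _ w)); exact: measurable_behead.
Qed.

Lemma rowt_row_mx n (x : 'M[R]_1) (r : 'rV[R]_n) :
  rowt (row_mx x r : 'rV_(1 + n)) = ctuple (x 0 0) (rowt r).
Proof.
apply/eq_from_tnth => i; rewrite tnth_mktuple.
have [j ->|->] := unliftP ord0 i.
  rewrite tnthS tnth_mktuple -[RHS](row_mxEr x r 0 j); congr (row_mx _ _ _ _).
  exact/val_inj.
rewrite tnth0 -[RHS](row_mxEl x r 0 0); congr (row_mx _ _ _ _); exact/val_inj.
Qed.

Lemma trow_thead n (t : n.+1.-tuple R) :
  trow t = row_mx (thead t)%:M (trow [tuple of behead t]) :> 'rV_(1 + n).
Proof.
rewrite -[RHS]rowtK rowt_row_mx trowK mxE eqxx mulr1n; congr trow.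
by rewrite [LHS]tuple_eta; exact/val_inj.
Qed.

Lemma linT_block n (a : 'M[R]_1) (u : 'rV[R]_n) (w : 'cV[R]_n) (B : 'M[R]_n)
    (t : n.+1.-tuple R) :
  linT (block_mx a u w B : 'M[R]_(1 + n)) t =
  ctuple (thead t * a 0 0 + (trow [tuple of behead t] *m w) 0 0)
    (rowt (thead t *: u + trow [tuple of behead t] *m B)).
Proof.
rewrite /linT trow_thead (mul_row_block _ _ a u w B) rowt_row_mx !mul_scalar_mx.
by rewrite !mxE.
Qed.

(* Gaussian elimination: a tail translation makes the pivot nonzero, then a head
   map and a linear tail map (the Schur complement) remain. *)
Lemma dominated_linT n (M : 'M[R]_n) : M \in unitmx -> exists C, dominated C (linT M).
Proof.
elim: n M => [|n IH] M Mu.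
  exists 1; split => //; first exact: measurable_linT.
  move=> A mA; rewrite mul1e (_ : _ @^-1` A = A)//.
  by apply/seteqP; split => t /=; rewrite (tuple0 (linT _ _)) (tuple0 t).
pose M' : 'M[R]_(1 + n) := M.
(* If the corner vanishes, invertibility puts a nonzero entry below it, and the matching unit row
   [v] brings that entry into the corner. *)
have [v a0] : exists v : 'rV[R]_n, (ulsubmx M' - v *m dlsubmx M') 0 0 != 0.
  have [a0|] := eqVneq (ulsubmx M' 0 0) 0; last first.
    by move=> a0; exists 0; rewrite mul0mx subr0.
  have [w0|/cV0Pn[j wj]] := eqVneq (dlsubmx M') 0.
    have : \det M' != 0 by rewrite -unitfE -unitmxE.
    rewrite -[M']submxK w0 det_ublock det_mx11 a0 mul0r eqxx //.
  exists (delta_mx 0 j); rewrite -rowE !mxE.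
  by move: a0 wj; rewrite !mxE => -> ; rewrite sub0r oppr_eq0.
pose a := (ulsubmx M' - v *m dlsubmx M') 0 0.
pose u := ursubmx M' - v *m drsubmx M'.
pose w := dlsubmx M'; pose B := drsubmx M'.
pose S : 'M[R]_(1 + n) := block_mx 1%:M v 0 1%:M.
pose H : 'M[R]_(1 + n) := block_mx a%:M 0 w 1%:M.
pose B' := B - w *m (a^-1 *: u).
pose T : 'M[R]_(1 + n) := block_mx 1%:M (a^-1 *: u) 0 B'.
have aE : a%:M = ulsubmx M' - v *m w by rewrite [RHS]mx11_scalar.
(* Rows are multiplied on the right, so [S] acts first: a shear of the tail, then a map of the head,
   then [B'] on the tail followed by a translation depending on the head. *)
have ME : M' = S *m H *m T.
  rewrite /S /H /T !mulmx_block !mul1mx !mul0mx !mulmx1 !mulmx0 !addr0 !add0r.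
  rewrite -[LHS]submxK; congr block_mx; first by rewrite aE subrK.
    rewrite mulmxDl mul_scalar_mx scalerA mulfV// scale1r /B' mulmxBr mulmxA.
    by rewrite -addrA (addrC (_ *m _ *m _)) subrK subrK.
  by rewrite mul1mx /B' addrC subrK.
have [C domC] : exists C, dominated C (linT B').
  apply: IH; rewrite unitmxE; move: Mu; rewrite -[M]/M' ME !unitmx_mul => /andP[_].
  by rewrite unitmxE /T (@det_ublock _ 1 n) det1 mul1r.
have domS : dominated 1 (linT S).
  pose f x (t : n.-tuple R) := rowt (trow t + x *: v).
  have SE : linT S = fun t => ctuple (thead t) (f (thead t) [tuple of behead t]).
    by apply/funext => t; rewrite linT_block mulmx0 mulmx1 !mxE eqxx mulr1 addr0 addrC.
  rewrite SE; apply: dominated_tail; first by move=> x; exact: dominated_translate.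
  by rewrite -SE; exact: measurable_linT.
have domH : dominated (`|a|^-1) (linT H).
  have -> : linT H = fun t => ctuple (a * thead t + (trow [tuple of behead t] *m w) 0 0)
      [tuple of behead t].
    apply/funext => t; rewrite linT_block scaler0 add0r mulmx1 trowK !mxE.
    by rewrite eqxx mulr1n mulrC.
  exact: (@dominated_head n a (fun t => (trow t *m w) 0 0) a0 (measurable_mul_trow w)).
have domT : dominated (C * 1) (linT T).
  pose f x (t : n.-tuple R) := rowt (trow (linT B' t) + x *: (a^-1 *: u)).
  have TE : linT T = fun t => ctuple (thead t) (f (thead t) [tuple of behead t]).
    apply/funext => t; rewrite linT_block mulmx0 !mxE eqxx mulr1 addr0 addrC.
    by rewrite /f /linT rowtK.
  rewrite TE; apply: dominated_tail; last by rewrite -TE; exact: measurable_linT.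
  by move=> x; apply: dominated_comp domC (dominated_translate _).
exists ((1 * `|a|^-1) * (C * 1)).
by rewrite -[M]/M' ME !linT_mul; apply: dominated_comp => //; exact: dominated_comp.
Qed.

End dominated_maps.

(** * The volume density *)

Section form_theory.
Context {R : realType} {p q : nat}.
Local Notation V := 'rV[R]_(p + q + 1).
Implicit Types (x y z : V) (c : R).

Definition eta (i : nat) : R := if (i < p)%N then 1 else -1.

Lemma formE x y : form x y = \sum_(i < p + q + 1) eta i * (x 0 i * y 0 i).
Proof.
rewrite /form /form_mx mul_mx_diag mxE; apply: eq_bigr => i _.
by rewrite !mxE mulrAC mulrC mulrA.
Qed.

Lemma formC x y : form x y = form y x.
Proof. by rewrite !formE; apply: eq_bigr => i _; rewrite (mulrC (x 0 i)). Qed.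

Lemma formDl x y z : form (x + y) z = form x z + form y z.
Proof. by rewrite /form !mulmxDl mxE. Qed.

Lemma formZl c x y : form (c *: x) y = c * form x y.
Proof. by rewrite /form -!scalemxAl mxE. Qed.

Lemma formDr x y z : form z (x + y) = form z x + form z y.
Proof. by rewrite formC formDl !(formC z). Qed.

Lemma formZr c x y : form x (c *: y) = c * form x y.
Proof. by rewrite formC formZl formC. Qed.

Lemma formNl x y : form (- x) y = - form x y.
Proof. by rewrite -scaleN1r formZl mulN1r. Qed.

Lemma form0l y : form 0 y = 0.
Proof. by rewrite -(scale0r 0) formZl mul0r. Qed.

Lemma form_suml (I : finType) (f : I -> V) y :
  form (\sum_i f i) y = \sum_i form (f i) y.
Proof.
by elim/big_rec2: _ => [|i a b _ <-]; rewrite ?form0l// formDl.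
Qed.

Lemma form_sumr (I : finType) (f : I -> V) y :
  form y (\sum_i f i) = \sum_i form y (f i).
Proof. by rewrite formC form_suml; apply: eq_bigr => i _; rewrite formC. Qed.

Lemma normr_det_form_mx : `|\det (form_mx R p q)| = 1.
Proof.
rewrite /form_mx det_diag normr_prod big1// => i _.
by rewrite mxE; case: ifP; rewrite ?normrN normr1.
Qed.

End form_theory.
Arguments eta {R} p i.

Section jacobian_coordinates.
Context {R : realType}.

Lemma is_diff_coord m (y : 'rV[R]_m) (i : 'I_m) :
  is_diff y (fun z : 'rV[R]_m => z 0 i : R) (fun z => z 0 i).
Proof.
have @f : {linear 'rV[R]_m -> R}.
  by exists (fun N : 'rV[R]_m => N 0 i); do 2![eexists]; do ?[constructor];
     rewrite ?mxE// => ? *; rewrite ?mxE//; move=> ?; rewrite !mxE.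
have fc : continuous f by exact: coord_continuous.
apply: DiffDef; first exact: (linear_differentiable (f := f) y fc).
exact: (diff_lin (f := f) y fc).
Qed.

Lemma is_diff_sum (V W : normedModType R) m (k dk : 'I_m -> V -> W) (y : V) :
  (forall j, is_diff y (k j) (dk j)) -> is_diff y (\sum_j k j) (\sum_j dk j).
Proof.
move=> kdk; elim/big_rec2: _ => [|i a b _ ab]; first exact: is_diff_cst.
exact: is_diffD.
Qed.

Lemma jacobian_row n m (k dk : 'I_m -> 'rV[R]_n -> R) (y : 'rV[R]_n) :
  (forall j, is_diff y (k j) (dk j)) ->
  jacobian (fun z => \row_j k j z) y = \matrix_(i, j) dk j (delta_mx 0 i).
Proof.
move=> kdk; pose h j z : 'rV[R]_m := k j z *: delta_mx 0 j.
have hE : (fun z => \row_j k j z) = \sum_j h j.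
  apply/funext => z; rewrite fct_sumE; apply/rowP => j.
  rewrite summxE (bigD1 j)//= big1 ?addr0 => [|i ij]; rewrite !mxE ?eqxx ?mulr1//.
  by rewrite eq_sym (negbTE ij) mulr0.
have hd j : is_diff y (h j) (fun v => dk j v *: delta_mx 0 j).
  have [kd <-] := kdk j; apply: DiffDef; first exact: differentiableZl.
  by rewrite diffZl.
have [_ hsum] := is_diff_sum hd.
apply/matrixP => i j; rewrite /jacobian hE !mxE hsum fct_sumE summxE.
rewrite (bigD1 j)//= big1 ?addr0 => [|l lj]; rewrite !mxE ?eqxx ?mulr1//.
by rewrite eq_sym (negbTE lj) mulr0.
Qed.

End jacobian_coordinates.

Section volume_density.
Context {R : realType} {p q : nat}.
Local Notation n := (p + q)%N.
Local Notation F := (form_mx R p q).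
Implicit Types y v : 'rV[R]_n.

(** Positive exactly on the part of the chart that lies in H^(p,q); there [hyperboloid y] is
    [affine_point y] divided by its square root. *)
Definition Nform y : R := - form (affine_point y) (affine_point y).

Let lin v : 'rV[R]_(n + 1) := row_mx v 0.

Lemma is_diff_affine_coord y (j : 'I_(n + 1)) :
  is_diff y (fun z : 'rV[R]_n => affine_point z 0 j) (fun v : 'rV[R]_n => lin v 0 j).
Proof.
case: (split_ordP j) => i ->.
  under [X in is_diff _ X _]eq_fun do rewrite row_mxEl.
  under [X in is_diff _ _ X]eq_fun do rewrite row_mxEl.
  exact: is_diff_coord.
under [X in is_diff _ X _]eq_fun do rewrite row_mxEr.
under [X in is_diff _ _ X]eq_fun do rewrite row_mxEr mxE.
exact: is_diff_cst.
Qed.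

Lemma is_diff_Nform y :
  is_diff y Nform (fun v => - (form (lin v) (affine_point y) *+ 2)).
Proof.
have aE j := is_diff_affine_coord y j.
have := is_diff_sum (fun j => is_diffZ (- @eta R p j) (is_diffM (aE j) (aE j))).
set k := \sum_j _; set dk := \sum_j _.
have -> : k = Nform.
  apply/funext => z; rewrite /k fct_sumE /Nform formE -sumrN; apply: eq_bigr => j _ /=.
  by rewrite -mulNr.
have -> // : dk = (fun v => - (form (lin v) (affine_point y) *+ 2)).
apply/funext => v; rewrite /dk fct_sumE formE -sumrMnl -sumrN; apply: eq_bigr => j _ /=.
rewrite /=.
set b := lin v 0 j; set c := affine_point y 0 j; set e := eta _ _.
change (- e * (c * b + c * b) = - (e * (b * c) *+ 2)).
by ring.
Qed.

Lemma is_diff_invsqrt (x : R) : 0 < x ->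
  is_diff x (fun x => (Num.sqrt x)^-1) (fun h => h * (- ((Num.sqrt x) ^- 3 / 2))).
Proof.
move=> x0; have s0 : Num.sqrt x != 0 by rewrite gt_eqF// sqrtr_gt0.
have [ds sE] := is_derive1_sqrt x0.
have dV : derivable (fun x => (Num.sqrt x)^-1) x 1 by exact: derivableV.
apply: DiffDef; first exact/derivable1_diffP.
rewrite deriv1E//; apply/funext => h; congr (_ * _).
rewrite derive1E deriveV// sE /GRing.scale /= mulNr; congr (- _).
by field.
Qed.

Definition invN y := (Num.sqrt (Nform y))^-1.

Lemma invN_sqr y : 0 < Nform y -> invN y ^+ 2 = (Nform y)^-1.
Proof. by move=> N0; rewrite /invN exprVn sqr_sqrtr// ltW. Qed.

Lemma is_diff_invN y : 0 < Nform y ->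
  is_diff y invN (fun v => form (lin v) (affine_point y) * (invN y / Nform y)).
Proof.
move=> N0; have s0 : Num.sqrt (Nform y) != 0 by rewrite gt_eqF// sqrtr_gt0.
have dN := is_diff_Nform y; have ds := is_diff_invsqrt N0.
have := is_diff_comp dN ds=> dfg; apply: (is_diff_eq dfg); apply/funext => v /=.
rewrite /invN -{3}(@sqr_sqrtr _ (Nform y)) ?ltW//.
by field.
Qed.

Let E : 'M[R]_(n, n + 1) := row_mx 1%:M 0.

Lemma jacobian_hyperboloid y : 0 < Nform y ->
  jacobian (@hyperboloid R p q) y = invN y *:
    (E + (Nform y)^-1 *: (E *m F *m (affine_point y)^T) *m affine_point y).
Proof.
move=> N0; have dg := is_diff_invN N0.
have -> : @hyperboloid R p q = fun z => \row_j (invN * (fun z => affine_point z 0 j)) z.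
  by apply/funext => z; apply/rowP => j; rewrite /hyperboloid [LHS]mxE [RHS]mxE.
rewrite (jacobian_row (fun j => is_diffM dg (is_diff_affine_coord y j))).
apply/matrixP => i j; rewrite [RHS]mxE [in RHS]mxE.
have linE : lin (delta_mx 0 i) = row i E.
  by rewrite row_row_mx row0 row1.
have fE : form (lin (delta_mx 0 i)) (affine_point y) =
    (E *m F *m (affine_point y)^T) i 0.
  by rewrite /form linE -!row_mul mxE.
rewrite [LHS]mxE.
change (invN y * lin (delta_mx 0 i) 0 j + affine_point y 0 j *
  (form (lin (delta_mx 0 i)) (affine_point y) * (invN y / Nform y)) = invN y *
  (E i j + ((Nform y)^-1 *: (E *m F *m (affine_point y)^T) *m affine_point y) i j)).
rewrite fE linE [row i E 0 j]mxE.
rewrite [X in _ * (_ + X)]mxE big_ord1 [(_ *: (_ *m _)) _ _]mxE.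
set b := E i j; set c := affine_point y 0 j; set d := (_ *m _) i 0.
set g := invN y; set N := Nform y.
change (g * b + c * (d * (g / N)) = g * (b + N^-1 * d * c)).
by ring.
Qed.

(* Completing the Jacobian matrix J with the row h := hyperboloid y gives the
   block diagonal Gram matrix diag(metric, -1), because h^perp is the tangent
   space; row operations turn (J, h) into a triangular matrix. *)
Lemma normr_det_metric_mx y : 0 < Nform y ->
  `|\det (metric_mx y)| = (Nform y) ^- (p + q + 1).
Proof.
move=> N0; set N := Nform y; set g := invN y; set a := affine_point y.
have N0' : N != 0 by rewrite gt_eqF.
have g0 : g != 0 by rewrite invr_neq0// gt_eqF// sqrtr_gt0.
pose u := E *m F *m a^T.
pose J := jacobian (@hyperboloid R p q) y.
have JE : J = g *: E + (N^-1 *: u) *m (g *: a).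
  by rewrite /J jacobian_hyperboloid// scalerDr -scalemxAr.
have FT : F^T = F by rewrite tr_diag_mx.
have aFa : a *m F *m a^T = (- N)%:M.
  by rewrite [LHS]mx11_scalar opprK.
have JFa : J *m F *m a^T = 0.
  have e2 : (N^-1 *: u) *m (g *: a) *m F *m a^T = - (g *: u).
    rewrite -!mulmxA -(scalemxAl g) (mulmxA a) aFa -scalemxAr mul_mx_scalar.
    by rewrite !scalerA -scaleNr; congr (_ *: _); field.
  by rewrite JE !mulmxDl e2 -!scalemxAl subrr.
have aFJ : a *m F *m J^T = 0.
  by apply: trmx_inj; rewrite !trmx_mul trmxK FT mulmxA JFa trmx0.
pose K : 'M[R]_(n + 1) := col_mx J (g *: a).
have KFK : K *m F *m K^T = block_mx (metric_mx y) 0 0 (-1)%:M.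
  rewrite /K mul_col_mx tr_col_mx mul_col_row; congr block_mx.
  - by rewrite linearZ /= -scalemxAr JFa scaler0.
  - by rewrite -!scalemxAl aFJ scaler0.
  - rewrite linearZ /= -!scalemxAl -scalemxAr aFa !scale_scalar_mx; congr (_%:M).
    by rewrite mulrA -expr2 invN_sqr// mulrN mulVf.
have detK : \det K = g ^+ (n + 1).
  have -> : K = block_mx 1%:M (N^-1 *: u) 0 1%:M *m block_mx (g%:M) 0 (g *: y) (g%:M).
    rewrite mulmx_block !mul1mx !mul0mx !add0r /K JE /E /a /affine_point.
    rewrite scale_row_mx scale_row_mx mul_mx_row add_row_mx /block_mx scaler0 add0r.
    by rewrite !scalemx1.
  rewrite det_mulmx det_ublock !det1 mul1r mul1r det_lblock !det_scalar.
  by rewrite -exprD.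
have : \det (K *m F *m K^T) = - \det (metric_mx y).
  by rewrite KFK det_ublock det_scalar expr1 mulrN1.
rewrite !det_mulmx det_tr => dE.
rewrite -normrN -dE !normrM normr_det_form_mx mulr1 -normrM detK.
rewrite -expr2 -exprM mulnC exprM /g invN_sqr// ger0_norm ?exprVn//.
by rewrite invr_ge0 exprn_ge0// ltW.
Qed.

Lemma volume_densityE y : 0 < Nform y ->
  volume_density y = Num.sqrt (Nform y ^- (p + q + 1)).
Proof. by move=> N0; rewrite /volume_density normr_det_metric_mx. Qed.

End volume_density.

(** * Cones over projective convex hulls *)

Section simplicial_cone.
Context {R : realType} {m : nat}.
Notation V := 'rV[R]_m.
Notation P := (proj_space R m).
Implicit Types (v : 'I_m -> V) (c : V) (x y : V) (A : set V) (xi : P).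

Lemma convex_setE A : convex_set (A : set (convex_lmodType V)) <->
  forall x y l, A x -> A y -> 0 <= l -> l <= 1 -> A (l *: x + (1 - l) *: y).
Proof.
split => [cA x y l Ax Ay l0 l1|cA x y l /set_mem Ax /set_mem Ay].
  have := cA x y (Itv01 l0 l1); rewrite !inE; exact.
by rewrite inE; exact: cA.
Qed.

Definition frame_mx v : 'M[R]_m := \matrix_i v i.

Lemma mul_frame_mx v c : c *m frame_mx v = \sum_i c 0 i *: v i.
Proof. by rewrite mulmx_sum_row; apply: eq_bigr => i _; rewrite rowK. Qed.

Lemma conv_hull_frame v x : conv_hull (range v) x ->
  exists c, [/\ x = c *m frame_mx v, forall i, 0 <= c 0 i & \sum_i c 0 i = 1].
Proof.
pose K : set V := [set y | exists c, [/\ y = c *m frame_mx v, forall i, 0 <= c 0 i &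
  \sum_i c 0 i = 1]].
move=> /(_ K); apply; split => [|_ [i _ <-]]; last first.
  exists (delta_mx 0 i); rewrite -rowE rowK; split => //.
    by move=> j; rewrite mxE; case: (_ && _).
  rewrite (bigD1 i)//= big1 ?addr0 => [|j ji]; rewrite mxE eqxx ?eqxx//=.
  by rewrite (negbTE ji).
apply/convex_setE => _ _ l [c [-> c0 c1]] [d [-> d0 d1]] l0 l1.
exists (l *: c + (1 - l) *: d); split.
- by rewrite mulmxDl -!scalemxAl.
- by move=> i; rewrite !mxE addr_ge0// mulr_ge0// subr_ge0.
- under eq_bigr do rewrite !mxE.
  by rewrite big_split /= -!mulr_sumr c1 d1 !mulr1 addrC subrK.
Qed.

(** Vertices are added one at a time to a normalised partial barycentre; strict positivity keeps
    every partial weight [T] invertible. *)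
Lemma conv_hull_frame_pos v c : (forall i, 0 < c 0 i) -> \sum_i c 0 i = 1 ->
  conv_hull (range v) (c *m frame_mx v).
Proof.
move=> c0 c1 A [/convex_setE cA vA].
have Av i : A (v i) by apply: vA; exists i.
have key (r : seq 'I_m) i0 : let T := \sum_(i <- i0 :: r) c 0 i in
    0 < T /\ A (T^-1 *: \sum_(i <- i0 :: r) c 0 i *: v i).
  elim: r i0 => [|j r IH] i0 /=.
    by rewrite !big_seq1; split=> //; rewrite scalerA mulVf ?scale1r// gt_eqF.
  rewrite big_cons [X in _ *: X]big_cons.
  have [] := IH j; set T := \sum_(_ <- _) _; set w := \sum_(_ <- _) _ => T0 Aw.
  have cT : 0 < c 0 i0 + T by rewrite addr_gt0.
  split=> //.
  have l0 : 0 <= c 0 i0 / (c 0 i0 + T) by apply: divr_ge0; apply: ltW.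
  have l1 : c 0 i0 / (c 0 i0 + T) <= 1.
    by rewrite ler_pdivrMr// mul1r lerDl; exact: ltW.
  move: (cA _ _ _ (Av i0) Aw l0 l1).
  congr A; rewrite scalerDr !scalerA; congr (_ *: _ + _ *: _); field.
    by rewrite gt_eqF.
  by rewrite !gt_eqF.
move: c1; rewrite mul_frame_mx -!big_enum.
case: (enum _) => [|i0 r] c1; first by move: c1; rewrite big_nil => /eqP; rewrite eq_sym oner_eq0.
by have [_] := key r i0; rewrite c1 invr1 scale1r.
Qed.

Lemma represents_line x y xi : represents x xi -> represents y xi ->
  exists2 k, k != 0 & y = k *: x.
Proof.
move=> /andP[x0 xxi] /andP[y0 yxi].
have xiE : \val xi = <[x]>%VS.
  apply/esym/eqP; rewrite eqEdim -memvE xxi /= (eqP (valP xi)) dim_vline x0//.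
move: yxi; rewrite xiE => /vlineP[k yE]; exists k => //.
by apply: contraNneq y0 => k0; rewrite yE k0 scale0r.
Qed.

Lemma representsZ x xi k : k != 0 -> represents x xi -> represents (k *: x) xi.
Proof.
move=> k0 /andP[x0 xxi]; apply/andP; split; first by rewrite scaler_eq0 negb_or k0.
exact: memvZ.
Qed.

Lemma line_subproof x : x != 0 -> \dim <[x]>%VS == 1%N.
Proof. by move=> x0; rewrite dim_vline x0. Qed.

Definition line x (x0 : x != 0) : P := exist _ <[x]>%VS (line_subproof x0).

Lemma represents_lineP x (x0 : x != 0) : represents x (line x0).
Proof. by rewrite /represents x0 memv_line. Qed.

Lemma frame_neq0 v i : frame_mx v \in unitmx -> v i != 0.
Proof.
move=> vu; apply/eqP => vi0; move: vu; rewrite unitmxE unitfE => /eqP; apply.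
by rewrite (expand_det_row _ i) big1// => j _; rewrite !mxE vi0 mxE mul0r.
Qed.

Lemma continuous_mulmx (B : 'M[R]_m) i : continuous (fun x : V => (x *m B) 0 i).
Proof.
move=> x; pose f (j : 'I_m) (x : V) : R := B j i *: x 0 j.
have -> : (fun x : V => (x *m B) 0 i) = \sum_j f j.
  by apply/funext => y; rewrite fct_sumE mxE; apply: eq_bigr => j _; rewrite mulrC.
apply: differentiable_continuous; apply: differentiable_sum => j.
by apply: differentiableZ; exact: differentiable_coord.
Qed.

Lemma open_frame_cone v : frame_mx v \in unitmx ->
  open [set x : V | exists2 c, x = c *m frame_mx v & forall i, 0 < c 0 i].
Proof.
move=> vu; pose f i (x : V) := (x *m invmx (frame_mx v)) 0 i.
rewrite (_ : [set _ | _] = [set x : V | forall i, 0 < f i x]); last first.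
  apply/seteqP; split => [_ [c -> c0] i /=|x x0]; first by rewrite /f mulmxK.
  by exists (x *m invmx (frame_mx v)); [rewrite mulmxKV|move=> i; exact: x0].
rewrite openE => x x0.
suff : \forall y \near x, forall i, 0 < f i y by [].
refine (@filter_forall V (Finite.clone _ (ordinal m)) (fun i => [set y : V | 0 < f i y]) (nbhs x) _ _) => i.
have : open [set y : V | 0 < f i y].
  apply: (@open_comp _ _ (f i) [set r | 0 < r]); last exact: open_gt.
  by move=> y _; exact: continuous_mulmx.
by rewrite openE; apply; exact: x0.
Qed.

(** The outer bound: an interior lies in its set. A projective point fixes its barycentric
    coordinates only up to a nonzero scalar, whence the two signs. *)
Lemma lift_hull_cone v (Lambda : set P) s x : s @` Lambda = range v ->
  cone (lift_hull Lambda s) x -> exists c, [/\ x = c *m frame_mx v, c != 0 &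
    (forall i, 0 <= c 0 i) \/ (forall i, c 0 i <= 0)].
Proof.
move=> sv [xi /interior_subset[w]]; rewrite sv => /conv_hull_frame[c [-> c0 c1]] wxi xxi.
have [k k0 ->] := represents_line wxi xxi.
exists (k *: c); split; first by rewrite scalemxAl.
  rewrite scaler_eq0 negb_or k0; apply/eqP => cE; move/eqP: c1.
  by rewrite cE big1 ?(eq_sym 0) ?oner_eq0// => i _; rewrite mxE.
have [k_ge0|k_lt0] := leP 0 k; [left|right] => i; rewrite mxE.
  exact: mulr_ge0.
by rewrite mulr_le0_ge0// ltW.
Qed.

(** The inner bound: the lines through strictly positive combinations form an open set inside the
    image of the hull, hence lie in its interior. *)
Lemma frame_cone_lift_hull v (Lambda : set P) s c : s @` Lambda = range v ->
  frame_mx v \in unitmx -> (0 < m)%N ->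
  (forall i, 0 < c 0 i) \/ (forall i, c 0 i < 0) ->
  cone (lift_hull Lambda s) (c *m frame_mx v).
Proof.
move=> sv vu m0 c0.
pose O : set P := [set xi | exists2 d : V, (forall i, 0 < d 0 i) &
  represents (d *m frame_mx v) xi].
have nz (d : V) : (forall i, 0 < d 0 i) -> d *m frame_mx v != 0.
  move=> d0; apply/eqP => /(congr1 (mulmx^~ (invmx (frame_mx v)))).
  rewrite mulmxK// mul0mx => dE; have := d0 (Ordinal m0).
  by rewrite dE mxE ltxx.
have oO : open O.
  rewrite /open /=.
  pose C := [set x : V | exists2 c, x = c *m frame_mx v & forall i, 0 < c 0 i].
  have CE : cone O = C `|` (-%R @^-1` C).
    apply/seteqP; split => [x [xi [d d0 dxi] xxi]|x [[d -> d0]|[d dE d0]]].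
    - have [k k0 ->] := represents_line dxi xxi.
      have [k_ge0|k_lt0] := leP 0 k; [left|right].
        exists (k *: d); first by rewrite scalemxAl.
        by move=> i; rewrite mxE mulr_gt0// lt_neqAle eq_sym k0.
      exists (- k *: d); first by rewrite -scalemxAl scaleNr.
      by move=> i; rewrite mxE mulr_gt0// oppr_gt0.
    - by exists (line (nz _ d0)); [exists d => //|]; exact: represents_lineP.
    - exists (line (nz _ d0)); first by exists d => //; exact: represents_lineP.
      rewrite -[x]opprK dE -scaleN1r; apply: representsZ.
        by rewrite oppr_eq0 oner_eq0.
      exact: represents_lineP.
  suff : open (cone O) by [].
  rewrite CE; apply: openU; first exact: open_frame_cone.
  apply: open_comp; last exact: open_frame_cone.
  by move=> x _; exact: opp_continuous.
have Osub : O `<=` lift_hull Lambda s.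
  rewrite /lift_hull -[X in X `<=` _]((interior_id O).1 oO).
  apply: interiorS => xi [d d0 dxi].
  pose T := \sum_i d 0 i.
  have T0 : 0 < T.
    rewrite /T (bigD1 (Ordinal m0))//= ltr_pwDl// sumr_ge0// => i _; exact: ltW.
  exists ((T^-1 *: d) *m frame_mx v).
    rewrite sv; apply: conv_hull_frame_pos.
      by move=> i; rewrite mxE mulr_gt0// invr_gt0.
    by under eq_bigr do rewrite mxE; rewrite -mulr_sumr mulVf// gt_eqF.
  by rewrite -scalemxAl; apply: representsZ => //; rewrite invr_neq0// gt_eqF.
case: c0 => c0.
  exists (line (nz _ c0)); last exact: represents_lineP.
  by apply: Osub; exists c => //; exact: represents_lineP.
have c0' i : 0 < (- c) 0 i by rewrite mxE oppr_gt0.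
exists (line (nz _ c0')).
  by apply: Osub; exists (- c) => //; exact: represents_lineP.
have -> : c *m frame_mx v = -1 *: (- c *m frame_mx v).
  by rewrite mulNmx scaleN1r opprK.
apply: representsZ.
  by rewrite oppr_eq0 oner_eq0.
exact: represents_lineP.
Qed.

End simplicial_cone.

(** * Simplices *)

Section simplices.
Context {R : realType} {p q : nat}.
Local Notation d := (p + q + 1)%N.
Local Notation V := 'rV[R]_d.
Local Notation P := (proj_space R d).
Implicit Types (v : 'I_d -> V) (c x : V) (Lambda A : set P) (s : P -> V) (e : 'I_d -> P).

Lemma cone_HpqP A x : cone (A `&` @Hpq R p q) x <-> cone A x /\ form x x < 0.
Proof.
split => [[xi [Axi Hxi] xxi]|[[xi Axi xxi] x0]].
  by split; [exists xi|exact: Hxi].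
exists xi => //; split=> // w wxi; have [k k0 ->] := represents_line xxi wxi.
rewrite formZl formZr mulrA -expr2 pmulr_rlt0//.
by rewrite lt_neqAle sqr_ge0 eq_sym expf_neq0.
Qed.

Lemma card_frame Lambda : (Lambda #= `I_d)%card ->
  exists2 e : 'I_d -> P, injective e & range e = Lambda.
Proof.
move=> /card_set_bijP[f [fun_f inj_f surj_f]].
have /choice[e eP] (i : 'I_d) : exists xi, Lambda xi /\ f xi = i.
  by have [xi Lxi fxi] := surj_f i (ltn_ord i); exists xi.
exists e => [i j eij|]; first by apply/val_inj => /=; rewrite -(eP i).2 -(eP j).2 eij.
apply/seteqP; split => [_ [i _ <-]|xi Lxi]; first exact: (eP i).1.
have fi : (f xi < d)%N := fun_f _ Lxi.
exists (Ordinal fi) => //; apply: inj_f; rewrite ?inE//; first exact: (eP _).1.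
by rewrite (eP _).2.
Qed.

Lemma span_frame_mx v x : x \in <<[seq v i | i <- enum 'I_d]>>%VS ->
  exists c : V, x = c *m frame_mx v.
Proof.
pose X : d.-tuple V := [tuple v i | i < d].
have -> : [seq v i | i <- enum 'I_d] = X by [].
move=> xX; exists (\row_i coord X i x).
rewrite mul_frame_mx {1}(coord_span xX); apply: eq_bigr => i _.
by rewrite mxE -tnth_nth tnth_mktuple.
Qed.

Lemma frame_mx_unit v : (forall x, exists c : V, x = c *m frame_mx v) ->
  frame_mx v \in unitmx.
Proof.
move=> vspan; rewrite -row_full_unit -sub1mx; apply/row_subP => i.
by have [c ->] := vspan (row i 1%:M); rewrite submxMl.
Qed.

Lemma spanning_frame Lambda s e : spanning Lambda -> is_lift Lambda s ->
  range e = Lambda -> frame_mx (s \o e) \in unitmx.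
Proof.
move=> spL lis eL; apply: frame_mx_unit => x; apply: span_frame_mx.
rewrite (_ : <<_>>%VS = fullv) ?memvf//; apply: spL => xi; rewrite -eL => -[i _ <-].
have /andP[s0 sxi] : represents (s (e i)) (e i) by apply: lis; rewrite -eL; exists i.
have -> : \val (e i) = <[s (e i)]>%VS.
  by apply/esym/eqP; rewrite eqEdim -memvE sxi /= (eqP (valP (e i))) dim_vline s0.
by rewrite -memvE memv_span//; apply/mapP; exists i; rewrite ?mem_enum.
Qed.

(** Coordinates with respect to independent vectors are unique, so a combination on the line of one
    vertex involves no other vertex. *)
Lemma extremal_frame Lambda s e : injective e -> range e = Lambda ->
  is_lift Lambda s -> frame_mx (s \o e) \in unitmx ->
  forall xi, Lambda xi -> extremal Lambda s xi.
Proof.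
move=> ie eL lis su xi; rewrite -{1}eL => -[k _ <-] t t0 t1 rep eta.
rewrite -{1}eL => -[i _ <-]; rewrite (inj_eq ie) => ik.
have sumE : \sum_(eta \in Lambda) t eta *: s eta = (\row_i t (e i)) *m frame_mx (s \o e).
  have -> : Lambda = [set` [seq e i | i <- enum 'I_d]].
    rewrite -eL; apply/seteqP; split => [_ [j _ <-]|_ /mapP[j _ ->]]; last by exists j.
    by apply/mapP; exists j; rewrite ?mem_enum.
  have ur : uniq [seq e i | i <- enum 'I_d] by rewrite (map_inj_uniq ie) enum_uniq.
  rewrite -fsbig_seq//= big_map big_enum /= mul_frame_mx.
  by apply: eq_bigr => j _; rewrite mxE.
have [|l _ sE] := represents_line (lis (e k) _) rep; first by rewrite -eL; exists k.
have : \row_i t (e i) = l *: delta_mx 0 k.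
  apply: (can_inj (mulmxK su)); rewrite -sumE sE -scalemxAl -rowE rowK //.
by move=> /rowP/(_ i); rewrite !mxE eqxx /= (negbTE ik) mulr0.
Qed.

Lemma simplex_frame Lambda s : simplex p q Lambda -> is_lift Lambda s ->
  exists e : 'I_d -> P, [/\ injective e, range e = Lambda &
    frame_mx (s \o e) \in unitmx].
Proof.
move=> [_ /card_frame[e ie eL] spL] lis; exists e; split=> //.
exact: (spanning_frame spL lis eL).
Qed.

(** Independence already gives distinct vertices, a hull that avoids 0 and extremality, so
    constructing a simplex amounts to finding a basis with nonpositive products. *)
Lemma simplex_range_line v (vu : frame_mx v \in unitmx) :
  (forall i j, form (v i) (v j) <= 0) ->
  let e i := line (frame_neq0 i vu) in
  simplex p q (range e) /\
  exists2 s, positive_lift (range e) s & forall i, s (e i) = v i.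
Proof.
move=> vneg e.
have ev i : represents (v i) (e i) by exact: represents_lineP.
have ie : injective e.
  move=> i j eij; have := ev j; rewrite -eij => /(represents_line (ev i))[k k0 vji].
  have : delta_mx 0 j = k *: delta_mx 0 i :> V.
    by apply: (can_inj (mulmxK vu)); rewrite -scalemxAl -!rowE !rowK.
  move=> /rowP/(_ j); rewrite !mxE !eqxx /=.
  by case: eqVneq => //= _; rewrite mulr0 => /eqP; rewrite oner_eq0.
pose s xi := if [pick i | e i == xi] is Some i then v i else 0.
have sE i : s (e i) = v i.
  rewrite /s; case: pickP => [j /eqP/ie->//|/(_ i)]; by rewrite eqxx.
have lis : is_lift (range e) s by move=> _ [i _ <-]; rewrite sE.
have sev : s \o e = v by apply/funext => i; exact: sE.
have plis : positive_lift (range e) s.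
  split=> //; last by move=> _ _ [i _ <-] [j _ <-]; rewrite !sE.
  rewrite image_comp sev => /conv_hull_frame[c [c0 _ c1]].
  move: c0 => /esym/(congr1 (mulmx^~ (invmx (frame_mx v)))); rewrite mulmxK// mul0mx => c0.
  by move/eqP: c1; rewrite c0 big1 ?(eq_sym 0) ?oner_eq0// => i _; rewrite mxE.
split; last by exists s.
have cardR : (range e #= `I_d)%card.
  apply/card_set_bijP.
  pose f xi : nat := if [pick i | e i == xi] is Some i then i else 0%N.
  have fE i : f (e i) = i.
    by rewrite /f; case: pickP => [j /eqP/ie->//|/(_ i)]; rewrite eqxx.
  exists f; split.
  - by move=> _ [i _ <-] /=; rewrite fE.
  - by move=> _ _ /set_mem[i _ <-] /set_mem[j _ <-]; rewrite !fE => /val_inj->.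
  - by move=> k /= kd; exists (e (Ordinal kd)); [exists (Ordinal kd)|rewrite fE].
split=> //.
  split; first by exists d.
  have su : frame_mx (s \o e) \in unitmx by rewrite sev.
  by exists s => //; exact: (extremal_frame ie erefl lis su).
move=> W We; apply/eqP; rewrite eqEsubv subvf; apply/subvP => x _.
rewrite -(mulmxKV vu x) mul_frame_mx; apply: memv_suml => i _; apply: memvZ.
have /andP[_ vei] := ev i; apply: (subvP (We (e i) _)) => //; by exists i.
Qed.

Lemma simplex_volume_lift Lambda : simplex p q Lambda -> exists2 s, positive_lift Lambda s &
  simplex_volume p q Lambda = @volume R p q (lift_hull Lambda s).
Proof.
move=> [[_ [s ps _]] _ _]; rewrite /simplex_volume.
have [s' ps' ->] : convex_hulls Lambda (xget set0 (convex_hulls Lambda)).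
  by apply: xgetPex; exists (lift_hull Lambda s), s.
by exists s'.
Qed.

End simplices.

(** * Infinite volume *)

(* Unlike [ge0_le_integral], no measurability is required: the integral of a
   nonnegative function is a supremum over the simple functions below it. *)
Lemma ge0_le_integral_nomeas d (T : measurableType d) (R : realType)
    (mu : {measure set T -> \bar R}) (f g : T -> \bar R) :
  (forall x, 0 <= f x)%E -> (forall x, f x <= g x)%E ->
  (\int[mu]_x f x <= \int[mu]_x g x)%E.
Proof.
move=> f0 fg; rewrite !ge0_integralTE//; last first.
  by move=> x; exact: le_trans (fg x).
by apply: ereal_sup_le => _ [h hf <-]; exists h => // x; exact: le_trans (fg x).
Qed.

(** Each of the disjoint boxes contributes at least [k], so the integral exceeds every multiple of
    [k]. Measurability enters only through the boxes, by comparison with the step functions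
    [g i]. *)
Lemma integral_pinfty_boxes d (T : measurableType d) (R : realType)
    (mu : {measure set T -> \bar R}) (D : set T) (f : T -> \bar R)
    (B : nat -> set T) (a : nat -> R) (k : R) :
  (forall x, D x -> 0 <= f x)%E -> (forall i, measurable (B i)) -> trivIset setT B ->
  (forall i, B i `<=` D) -> (forall i, 0 <= a i) ->
  (forall i x, B i x -> (a i)%:E <= f x)%E -> 0 < k ->
  (forall i, k%:E <= (a i)%:E * mu (B i))%E ->
  (\int[mu]_(x in D) f x = +oo)%E.
Proof.
move=> f0 mB tB BD a0 aB k0 kB.
have key N : ((N%:R * k)%:E <= \int[mu]_(x in D) f x)%E.
  pose g i x : \bar R := ((a i)%:E * (\1_(B i) x)%:E)%E.
  have g0 i x : (0 <= g i x)%E by rewrite mule_ge0 ?lee_fin.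
  have mg i : measurable_fun setT (g i).
    by apply: measurable_funeM; apply/measurable_EFinP; exact: measurable_indic.
  apply: (@le_trans _ _ (\int[mu]_x \sum_(i < N) g i x)%E); last first.
    rewrite [leRHS]integral_mkcond; apply: ge0_le_integral_nomeas.
      by move=> x; exact: sume_ge0.
    move=> x; case: (pselect (exists i : 'I_N, B i x)) => [[i Bix]|nB].
      rewrite (bigD1 i)//= big1 ?adde0; last first.
        move=> j ji; rewrite /g indicE memNset ?mule0// => Bjx.
        have /trivIsetP/(_ j i I I ji) /seteqP[/(_ x) h _] := tB.
        exact: h (conj Bjx Bix).
      rewrite /g indicE mem_set// mule1 patchE mem_set; last exact: BD Bix.
      exact: aB Bix.
    rewrite big1; last first.
      move=> i _; rewrite /g indicE memNset ?mule0// => Bix.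
      by apply: nB; exists i.
    by rewrite patchE; case: ifPn => // /set_mem; exact: f0.
  rewrite ge0_integral_sum//.
  have -> : (N%:R * k)%:E = (\sum_(i < N) k%:E)%E.
    by rewrite sumEFin sumr_const card_ord mulr_natl.
  apply: lee_sum => i _; rewrite ge0_integralZl//; last 2 first.
  - by apply/measurable_EFinP; exact: measurable_indic.
  - by rewrite lee_fin.
  by rewrite integral_indic ?setIT.
apply/eqyP => A A0.
have [N NA] : exists N : nat, A <= N%:R * k.
  exists (Num.bound (A / k)); rewrite -ler_pdivrMr//.
  by apply/ltW/archi_boundP/divr_ge0; exact: ltW.
by apply: le_trans (key N); rewrite lee_fin.
Qed.

Section infinite_volume.
Context {R : realType} {p q : nat}.
Local Notation n := (p + q)%N.
Local Notation V := 'rV[R]_(n + 1).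
Local Notation P := (proj_space R (n + 1)).
Local Notation "'e_ i" := (delta_mx 0 i : V) (at level 8, i at level 2).

Lemma form_delta (i : 'I_(n + 1)) (x : V) : form 'e_i x = eta p i * x 0 i.
Proof.
rewrite formE (bigD1 i)//= big1 ?addr0 => [|j ji]; rewrite mxE ?eqxx ?mul1r//=.
by rewrite (negbTE ji) !(mul0r, mulr0).
Qed.

(* v i0 and v il are isotropic, v i0 is orthogonal to all the other vertices
   except v il, and w is the frame of an arbitrary positive lift. *)
Variables (j0 : 'I_n) (w v : 'I_(n + 1) -> V) (c : 'I_(n + 1) -> R)
  (Lambda : set P) (s : P -> V).
Let i0 : 'I_(n + 1) := lshift 1 j0.
Let il : 'I_(n + 1) := rshift n ord0.

Hypothesis j0p : (j0 < p)%N.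
Hypothesis wE : forall i, w i = c i *: v i.
Hypothesis c0 : forall i, c i != 0.
Hypothesis wu : frame_mx w \in unitmx.
Hypothesis wneg : forall i j, form (w i) (w j) <= 0.
Hypothesis v0E : v i0 = 'e_i0 + 'e_il.
Hypothesis vlE : v il = - 'e_i0 + 'e_il.
Hypothesis vrE : forall i, i != i0 -> i != il -> v i 0 i0 = 0 /\ v i 0 il = 0.
Hypothesis sw : s @` Lambda = range w.

Let i0l : i0 != il.
Proof. by rewrite eq_lrshift. Qed.

Let eta0 : eta p i0 = 1 :> R.
Proof. by rewrite /eta /= j0p. Qed.

Let etal : eta p il = -1 :> R.
Proof. by rewrite /eta /= addn0 ltnNge leq_addr. Qed.

Let coord_sum (t : V) k : (t *m frame_mx w) 0 k = \sum_i t 0 i * (c i * v i 0 k).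
Proof.
by rewrite mxE; apply: eq_bigr => i _; rewrite mxE wE mxE.
Qed.

Let coord_split (t : V) k : (k == i0) || (k == il) -> (t *m frame_mx w) 0 k =
  t 0 i0 * (c i0 * v i0 0 k) + t 0 il * (c il * v il 0 k).
Proof.
move=> k0; rewrite coord_sum (bigD1 i0)//= (bigD1 il)/=; last by rewrite eq_sym.
rewrite big1 ?addr0// => i /andP[ii0 iil].
by have [h1 h2] := vrE ii0 iil; case/orP: k0 => /eqP->; rewrite ?h1 ?h2 !mulr0.
Qed.

Let coord0 (t : V) : (t *m frame_mx w) 0 i0 = t 0 i0 * c i0 - t 0 il * c il.
Proof.
rewrite coord_split ?eqxx// v0E vlE !mxE !eqxx /= (negbTE i0l).
by rewrite !mulr0n; ring.
Qed.

Let coordl (t : V) : (t *m frame_mx w) 0 il = t 0 i0 * c i0 + t 0 il * c il.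
Proof.
rewrite coord_split ?eqxx ?orbT// v0E vlE !mxE !eqxx /= eq_sym (negbTE i0l).
by rewrite !mulr0n; ring.
Qed.

Let form0l : form (v i0) (v il) = -2.
Proof.
rewrite v0E formDl !form_delta vlE !mxE !eqxx /= (negbTE i0l) eq_sym (negbTE i0l).
by rewrite eta0 etal !mulr0n !mulr1n; ring.
Qed.

(** A lift may reverse the vectors [v i], but since b(v i0, v il) = -2 is negative, a positive lift
    reverses [v i0] and [v il] together or not at all. *)
Let c0l : 0 < c i0 * c il.
Proof.
have := wneg i0 il; rewrite !wE formZl formZr form0l mulrA mulrN oppr_le0.
by rewrite pmulr_lge0// => h; rewrite lt_neqAle h eq_sym mulf_neq0.
Qed.

Let form_frame (t : V) : form (t *m frame_mx w) (t *m frame_mx w) =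
  \sum_i \sum_j t 0 i * t 0 j * form (w i) (w j).
Proof.
rewrite mul_frame_mx form_suml; apply: eq_bigr => i _.
by rewrite form_sumr; apply: eq_bigr => j _; rewrite formZl formZr mulrA.
Qed.

Let form_frame_lt0 (t : V) : (forall i j, 0 <= t 0 i * t 0 j) -> 0 < t 0 i0 * t 0 il ->
  form (t *m frame_mx w) (t *m frame_mx w) < 0.
Proof.
move=> t0 t0l; rewrite form_frame.
have le0 i j : t 0 i * t 0 j * form (w i) (w j) <= 0.
  by rewrite mulr_ge0_le0// t0.
rewrite (bigD1 i0)//= (bigD1 il)//=.
have lt0 : t 0 i0 * t 0 il * form (w i0) (w il) < 0.
  rewrite pmulr_rlt0// !wE formZl formZr form0l mulrA mulrN oppr_lt0.
  by rewrite mulr_gt0.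
have s1 : \sum_(i | i != il) t 0 i0 * t 0 i * form (w i0) (w i) <= 0.
  by apply: sumr_le0 => i _.
have s2 : \sum_(i | i != i0) \sum_j t 0 i * t 0 j * form (w i) (w j) <= 0.
  by apply: sumr_le0 => i _; apply: sumr_le0 => j _.
lra.
Qed.

(** Used for its sign: points of the chart near [v i0] lie in the cone when all their barycentric
    coordinates with respect to [w] have this sign. Accordingly [r0] below has all its remaining
    coordinates equal to [sg]. *)
Let sg := c i0.
Let B := invmx (frame_mx w).
Let rest i := (i != i0) && (i != il).
Let r0 : V := \sum_(i | rest i) sg *: w i.

Let rest_coord i k : rest i -> (k == i0) || (k == il) -> w i 0 k = 0.
Proof.
move=> /andP[ii0 iil] k0; rewrite wE mxE.
by have [h1 h2] := vrE ii0 iil; case/orP: k0 => /eqP->; rewrite ?h1 ?h2 mulr0.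
Qed.

Let wB i : w i *m B = 'e_i.
Proof. by rewrite -(rowK w) -/(frame_mx w) rowE -mulmxA mulmxV// mulmx1. Qed.

Let r0_coord k : (k == i0) || (k == il) -> r0 0 k = 0.
Proof.
move=> k0; rewrite summxE big1// => i ri; by rewrite mxE rest_coord// mulr0.
Qed.

Let r0B i : rest i -> (r0 *m B) 0 i = sg.
Proof.
move=> ri; rewrite mulmx_suml summxE (bigD1 i)//= big1 ?addr0 => [|j /andP[_ ji]];
  rewrite -scalemxAl wB !mxE ?eqxx ?mulr1//=.
by rewrite eq_sym (negbTE ji) mulr0.
Qed.

Let sg0 : sg != 0. Proof. exact: c0. Qed.

(** The sign condition is homogeneous, so a single [e] serves all the rescaled boxes of centre
    [z r0] and radius [z e]. *)
Let box_radius : exists2 e : R, 0 < e & forall y : V,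
  (forall k, `|y 0 k - r0 0 k| <= e) -> forall i, rest i -> 0 < sg * (y *m B) 0 i.
Proof.
have : \forall y \near r0, forall i, rest i -> 0 < sg * (y *m B) 0 i.
  refine (@filter_forall V (Finite.clone _ (ordinal (n + 1)))
    (fun i => [set y : V | rest i -> 0 < sg * (y *m B) 0 i]) (nbhs r0) _ _) => i.
  case: (boolP (rest i)) => ri; last by apply: nearW => y.
  have : open [set y : V | 0 < sg * (y *m B) 0 i].
    apply: (@open_comp _ _ (fun y : V => sg * (y *m B) 0 i) [set r | 0 < r]);
      last exact: open_gt.
    move=> y _; apply: continuousM; [exact: cst_continuous|exact: continuous_mulmx].
  rewrite openE => /(_ r0) /=; rewrite r0B// -expr2 exprn_even_gt0//= => /(_ sg0).
  by apply: filterS => y /= h _.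
move=> /nbhs_ballP[e /= e0 ball_e]; exists (e / 2); first exact: divr_gt0.
move=> y yr; apply: ball_e; split=> // i k /=; rewrite [i]ord1 /ball /= distrC.
by rewrite (le_lt_trans (yr k))// ltr_pdivrMr// ltr_pMr// ltr1n.
Qed.

Let pt (t : n.-tuple R) : V := affine_point (row_of_tuple t).

Let ptl t : pt t 0 il = 1.
Proof. by rewrite /pt /affine_point row_mxEr mxE. Qed.

Let ptE t j : pt t 0 (lshift 1 j) = tnth t j.
Proof. by rewrite /pt /affine_point row_mxEl mxE. Qed.

(** The coordinates [i0] and [il] of a point determine its barycentric coordinates at these two
    vertices. Subtracting their contribution and rescaling by [z^-1] leaves a point [y'] of the
    fixed box around [r0]. *)
Let in_hull e z t : 0 < z ->
  (forall y : V, (forall k, `|y 0 k - r0 0 k| <= e) ->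
    forall i, rest i -> 0 < sg * (y *m B) 0 i) ->
  0 < 1 + tnth t j0 -> 0 < 1 - tnth t j0 ->
  (forall j, j != j0 -> `|tnth t j - z * r0 0 (lshift 1 j)| <= z * e) -> 0 <= e ->
  cone (lift_hull Lambda s `&` @Hpq R p q) (pt t).
Proof.
move=> z0 eP y0 y1 tr e0.
pose T : V := pt t *m B.
have TE : pt t = T *m frame_mx w by rewrite mulmxKV.
have cT0 := coord0 T; have cTl := coordl T; rewrite -TE in cT0 cTl.
rewrite ptl in cTl; rewrite ptE in cT0.
(* By [cT0] and [cTl] the two products are (1 + t_j0) / 2 and (1 - t_j0) / 2. *)
have T0 : 0 < T 0 i0 * c i0 by lra.
have Tl : 0 < T 0 il * c il by lra.
pose y' : V := z^-1 *: (pt t - (T 0 i0 *: w i0 + T 0 il *: w il)).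
have y'B i : rest i -> (y' *m B) 0 i = z^-1 * T 0 i.
  move=> /andP[ii0 iil]; rewrite /y' -scalemxAl mulmxBl mulmxDl -!scalemxAl !wB -/T.
  by rewrite !mxE eqxx /= (negbTE ii0) (negbTE iil) !mulr0 addr0 subr0.
have y'r k : `|y' 0 k - r0 0 k| <= e.
  have v0k : v i0 0 k = (k == i0)%:R + (k == il)%:R by rewrite v0E !mxE.
  have vlk : v il 0 k = - (k == i0)%:R + (k == il)%:R by rewrite vlE !mxE.
  have y'E : y' 0 k = z^-1 * (pt t 0 k - (T 0 i0 * (c i0 * v i0 0 k) + T 0 il * (c il * v il 0 k))).
    have gen (X W1 W2 : V) a b c1 c2 : (z^-1 *: (X - (a *: (c1 *: W1) + b *: (c2 *: W2)))) 0 k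
        = z^-1 * (X 0 k - (a * (c1 * W1 0 k) + b * (c2 * W2 0 k))) by rewrite !mxE.
    by rewrite /y' !wE gen.
  rewrite y'E v0k vlk.
  have [ki0|ki0] := eqVneq k i0.
    rewrite r0_coord ?ki0 ?eqxx// (negbTE i0l) ptE cT0.
    rewrite (_ : _ - _ = 0) ?normr0//.
    by rewrite !mulr0n !mulr1n; ring.
  have [kil|kil] := eqVneq k il.
    rewrite r0_coord ?kil ?eqxx ?orbT// ptl.
    rewrite (_ : _ - _ = z^-1 * (1 - (T 0 i0 * c i0 + T 0 il * c il))).
      by rewrite -cTl subrr mulr0 normr0.
    by rewrite !mulr0n !mulr1n; ring.
  have [j kj] : exists j, k = lshift 1 j.
    case: (split_ordP k) => j kj; first by exists j.
    by move: kil; rewrite kj [j]ord1 eqxx.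
  rewrite !mulr0n oppr0 addr0 !mulr0 addr0 subr0 kj ptE.
  have jj0 : j != j0 by apply: contra_neq ki0 => jE; rewrite kj jE.
  rewrite -(ler_pM2l z0) -[X in X * `|_|](gtr0_norm z0) -normrM mulrBr mulrA mulfV ?mul1r ?gt_eqF//.
  exact: tr.
have sT i : 0 < sg * T 0 i.
  have [->|ii0] := eqVneq i i0; first by rewrite mulrC.
  have [->|iil] := eqVneq i il.
    have cl2 : 0 < c il ^+ 2 by rewrite exprn_even_gt0//= c0.
    have : 0 < (c i0 * c il) * (T 0 il * c il) by rewrite mulr_gt0.
    have -> : (c i0 * c il) * (T 0 il * c il) = (sg * T 0 il) * c il ^+ 2.
      by rewrite /sg; ring.
    by rewrite pmulr_lgt0.
  have := eP _ y'r i; rewrite /rest ii0 iil => /(_ isT).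
  by rewrite y'B ?/rest ?ii0 ?iil// mulrCA pmulr_rgt0// invr_gt0.
apply/cone_HpqP; split; last first.
  rewrite TE; apply: form_frame_lt0.
    move=> i j; have := ltW (mulr_gt0 (sT i) (sT j)).
    rewrite mulrACA -expr2 pmulr_rge0// exprn_even_gt0//=.
  have := mulr_gt0 (sT i0) (sT il).
  by rewrite mulrACA -expr2 pmulr_rgt0// exprn_even_gt0.
rewrite TE; apply: (frame_cone_lift_hull sw wu); first by rewrite addn1.
have [s0|s0|sE] := ltgtP 0 sg; [left|right|by move: sg0; rewrite -sE eqxx] => i.
  by have := sT i; rewrite pmulr_rgt0.
by have := sT i; rewrite nmulr_rgt0.
Qed.

Let Nform_le (K z : R) (t : n.-tuple R) : 0 <= z -> 0 <= K -> `|1 - tnth t j0 ^+ 2| <= 4 * z ^+ 2 ->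
  (forall j, j != j0 -> `|tnth t j| <= z * K) ->
  Nform (row_of_tuple t) <= z ^+ 2 * (4 + n%:R * K ^+ 2).
Proof.
move=> z0 K0 y0 yj; rewrite /Nform formE big_split_ord /= big_ord1 -/(pt t).
have -> : eta p (n + 0) = -1 :> R by rewrite /eta addn0 ltnNge leq_addr.
rewrite (_ : rshift _ _ = il)// ptl (bigD1 j0)//= ptE [eta p j0]eta0.
have : - \sum_(i < n | i != j0) (eta p i * (pt t 0 (lshift 1 i) * pt t 0 (lshift 1 i)))
    <= \sum_(i < n | i != j0) (z * K) ^+ 2.
  rewrite -sumrN; apply: ler_sum => j jj0; rewrite ptE -expr2.
  have : tnth t j ^+ 2 <= (z * K) ^+ 2.
    by rewrite -[X in X <= _]real_normK ?num_real// lerXn2r ?nnegrE ?mulr_ge0// yj.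
  have := sqr_ge0 (tnth t j); rewrite /eta; case: ifP => _; lra.
have : \sum_(i < n | i != j0) (z * K) ^+ 2 <= n%:R * (z * K) ^+ 2.
  rewrite sumr_const -[X in X <= _]mulr_natl ler_wpM2r ?sqr_ge0// ler_nat.
  by rewrite -[X in (_ <= X)%N]card_ord max_card.
have := ler_norm (1 - tnth t j0 ^+ 2); rewrite exprMn => h1 h2 h3.
rewrite mulrDr [_ * (n%:R * _)]mulrCA [z ^+ 2 * 4]mulrC.
rewrite !mul1r !mulr1 -expr2; lra.
Qed.

(** For i < j one has 2 z_j^2 <= z_i^2, which makes the intervals ]1 - 2 z_k^2, 1 - z_k^2[ disjoint;
    starting at 1/2 keeps them inside ]-1, 1[. *)
Let z (k : nat) : R := 2^-1 ^+ k.+1.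

Let z_gt0 k : 0 < z k. Proof. by rewrite exprn_gt0// invr_gt0. Qed.

Let z_half k : z k <= 2^-1.
Proof. by rewrite /z exprS ler_piMr ?invr_ge0// exprn_ile1// ?invr_ge0// invf_le1// ler1n. Qed.

Let z_lt i j : (i < j)%N -> z j <= 2^-1 * z i.
Proof.
move=> ij; rewrite /z -exprS; apply: ler_wiXn2l; rewrite ?invr_ge0// ?ltnS//.
by rewrite invf_le1// ler1n.
Qed.

Lemma volume_lift_hull_pinfty : @volume R p q (lift_hull Lambda s) = +oo%E.
Proof.
have [e e0 eP] := box_radius.
(* The boxes shrink towards [v i0] at rate z ^ 2 in the direction of the edge
   v i0, v il and at rate z in the n - 1 orthogonal directions, so that
   -b ~ z ^ 2 there: (z ^ 2)^(-(n + 1) / 2) * (z ^ 2 * z ^ (n - 1)) is constant. *)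
pose I k (j : 'I_n) : set R := if j == j0 then `]1 - 2 * z k ^+ 2, 1 - z k ^+ 2[%classic
  else `[z k * (r0 0 (lshift 1 j) - e), z k * (r0 0 (lshift 1 j) + e)]%classic.
pose Bx k := [set t : n.-tuple R | forall j, I k j (tnth t j)].
have mI k j : measurable (I k j) by rewrite /I; case: ifP.
pose K := \sum_k `|r0 0 k| + e.
have K0 : 0 <= K by rewrite addr_ge0 ?sumr_ge0// ltW.
pose C := 4 + n%:R * K ^+ 2.
have C0 : 0 < C by rewrite ltr_pwDl// mulr_ge0// sqr_ge0.
(* [a k] is the lower bound of the density that follows from [Nform <= z k ^+ 2 * C]; its product
   with the measure z_k^2 (2 e z_k)^(n - 1) of the box is [kap], independent of [k]. *)
pose a k : R := Num.sqrt (C ^- (n + 1)) * z k ^- (n + 1).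
pose kap : R := Num.sqrt (C ^- (n + 1)) * (2 * e) ^+ n.-1.
have Bx0 k t : Bx k t -> [/\ 1 - 2 * z k ^+ 2 < tnth t j0, tnth t j0 < 1 - z k ^+ 2 &
    forall j, j != j0 -> `|tnth t j - z k * r0 0 (lshift 1 j)| <= z k * e].
  move=> Bt; have := Bt j0; rewrite /I eqxx /= in_itv /= => /andP[h1 h2]; split=> //.
  move=> j jj0; have := Bt j; rewrite /I (negbTE jj0) /= in_itv /=.
  by rewrite mulrBr mulrDr => ?; rewrite ler_norml; lra.
have zz k : z k ^+ 2 <= 4^-1.
  have := z_half k; have := z_gt0 k => h1 h2.
  have -> : 4^-1 = (2^-1) ^+ 2 :> R by field.
  by rewrite lerXn2r ?nnegrE ?invr_ge0// ltW.
have z2 k : 0 < z k ^+ 2 by rewrite exprn_gt0.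
have BD k t : Bx k t -> cone (lift_hull Lambda s `&` @Hpq R p q) (pt t).
  move=> /Bx0[h1 h2 h3]; have := zz k; have := z2 k => h4 h5.
  by apply: (in_hull (z_gt0 k) eP) => //; [lra|lra|exact: ltW].
rewrite /volume; apply: (@integral_pinfty_boxes _ _ _ _ _ _ Bx a kap).
- by move=> t _; rewrite lee_fin sqrtr_ge0.
- by move=> k; exact: measurable_box.
- apply: ltn_trivIset => j i ij; apply/seteqP; split => // t [/Bx0[g1 g2 _] /Bx0[h1 h2 _]].
  have := z_lt ij; have := z_gt0 i; have := z_gt0 j => zj zi zij.
  suff : 2 * z j ^+ 2 <= z i ^+ 2 by lra.
  have : z j ^+ 2 <= (2^-1 * z i) ^+ 2.
    by rewrite -subr_ge0 subr_sqr mulr_ge0 //; lra.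
  by rewrite exprMn; have := z2 i; lra.
- by move=> k t /BD.
- by move=> k; rewrite mulr_ge0 ?sqrtr_ge0// invr_ge0 exprn_ge0// ltW.
- move=> k t Bt; rewrite lee_fin.
  have [_ N0] := (cone_HpqP _ _).1 (BD _ _ Bt).
  have {}N0 : 0 < Nform (row_of_tuple t) by rewrite /Nform oppr_gt0.
  rewrite volume_densityE//.
  have NC : Nform (row_of_tuple t) <= z k ^+ 2 * C.
    have [h1 h2 h3] := Bx0 _ _ Bt; have := zz k; have := z2 k => h4 h5.
    apply: Nform_le => //; first exact: ltW.
      have -> : 1 - tnth t j0 ^+ 2 = (1 - tnth t j0) * (1 + tnth t j0) by ring.
      rewrite ger0_norm; last by apply: mulr_ge0; lra.
      apply: (@le_trans _ _ ((2 * z k ^+ 2) * 2)); last lra.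
      by apply: ler_pM; lra.
    move=> j jj0; have := h3 _ jj0.
    have : `|r0 0 (lshift 1 j)| <= K - e.
      rewrite /K addrK (bigD1 (lshift 1 j))//= lerDl sumr_ge0//.
    move=> r1 r2; rewrite -[tnth t j](subrK (z k * r0 0 (lshift 1 j))).
    rewrite (le_trans (ler_normD _ _))// normrM (gtr0_norm (z_gt0 k)).
    rewrite (_ : z k * K = z k * e + z k * (K - e)); last by ring.
    by rewrite lerD// ler_wpM2l// ltW.
  have -> : a k = Num.sqrt ((z k ^+ 2 * C) ^- (n + 1)).
    rewrite exprMn invfM exprAC -exprVn sqrtrM ?sqr_ge0// sqrtr_sqr ger0_norm ?invr_ge0 ?exprn_ge0 ?ltW//.
    by rewrite mulrC.
  rewrite ler_wsqrtr// lef_pV2 ?posrE ?exprn_gt0// ?mulr_gt0//.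
  by rewrite ler_pXn2r ?addn1 ?nnegrE ?(ltW N0)// mulr_ge0 ?ltW.
- by rewrite mulr_gt0 ?exprn_gt0 ?mulr_gt0// sqrtr_gt0 invr_gt0 exprn_gt0.
- move=> k; rewrite [X in (_ * X)%E](lebesgue_box (mI k)).
  pose len j : R := if j == j0 then z k ^+ 2 else 2 * e * z k.
  rewrite (eq_bigr (fun j => (len j)%:E)); last first.
    move=> j _; rewrite /I /len; case: ifP => _; rewrite lebesgue_measure_itv /= lte_fin.
      rewrite ifT; last by have := z2 k; lra.
      by rewrite -EFinB; congr EFin; ring.
    rewrite ifT; last by rewrite ltr_pM2l// ltrD2l; lra.
    by rewrite -EFinB; congr EFin; ring.
  rewrite prodEFin -EFinM lee_fin (bigD1 j0)//= {1}/len eqxx.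
  rewrite (eq_bigr (fun=> 2 * e * z k)); last by move=> j; rewrite /len => /negbTE->.
  rewrite prodr_const (_ : #|_| = n.-1)%N; last by rewrite cardC1 card_ord.
  have n0 : (n + 1 = 2 + n.-1)%N by have := ltn_ord j0; lia.
  rewrite /a /kap [z k ^- _](_ : _ = z k ^- 2 * z k ^- n.-1); last by rewrite n0 exprD invfM.
  rewrite [X in _ <= X](_ : _ = Num.sqrt (C ^- (n + 1)) * (2 * e) ^+ n.-1)//.
  rewrite [(2 * e * z k) ^+ _]exprMn; set X := Num.sqrt _; set Y := (2 * e) ^+ _.
  have zk0 : z k != 0 by rewrite gt_eqF.
  have zn0 : z k ^+ n.-1 != 0 by rewrite expf_neq0.
  field.
  by rewrite zk0 zn0.
Qed.

End infinite_volume.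

(** * Simplices of infinite volume *)

Section simplices_of_infinite_volume.
Context {R : realType} {p q : nat}.
Local Notation n := (p + q)%N.
Local Notation V := 'rV[R]_(n + 1).

(** Indexed by [nat], and zero out of range, so that the positions 1, 2, [p] and [n] need no
    ordinal. *)
Definition basis_vec (k : nat) : V := \row_j (k == j)%:R.
Local Notation bv := basis_vec.

Lemma basis_vecE (k : 'I_(n + 1)) : (bv k) = delta_mx 0 k.
Proof. by apply/rowP => j; rewrite !mxE eqxx eq_sym. Qed.

Lemma form_basis_vec (k l : nat) : (k < n + 1)%N -> form (bv k) (bv l) = eta p k * (k == l)%:R.
Proof.
move=> kn; rewrite (basis_vecE (Ordinal kn)) form_delta.
by rewrite mxE eq_sym.
Qed.

Lemma frame_mx_unit_basis (v : 'I_(n + 1) -> V) :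
  (forall k : 'I_(n + 1), ((bv k) <= frame_mx v)%MS) -> frame_mx v \in unitmx.
Proof.
move=> ve; rewrite -row_full_unit -sub1mx; apply/row_subP => i.
by rewrite row1 -basis_vecE.
Qed.

Lemma ideal_rangeP (v : 'I_(n + 1) -> V) (vu : frame_mx v \in unitmx) :
  ideal p q (range (fun i => line (frame_neq0 i vu))) <->
  forall i, form (v i) (v i) = 0.
Proof.
split => [idv i|v0 _ [i _ <-] w wi].
  apply: (idv (line (frame_neq0 i vu))); last exact: represents_lineP.
  by exists i.
have [k _ ->] := represents_line (represents_lineP (frame_neq0 i vu)) wi.
by rewrite formZl formZr v0 !mulr0.
Qed.

Lemma simplex_pinfty (v : 'I_(n + 1) -> V) (vu : frame_mx v \in unitmx) : (0 < p)%N ->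
  (forall i j, form (v i) (v j) <= 0) ->
  (forall i : 'I_(n + 1), i = 0%N :> nat -> v i = (bv 0) + (bv n)) ->
  (forall i : 'I_(n + 1), i = n :> nat -> v i = - (bv 0) + (bv n)) ->
  (forall i k : 'I_(n + 1), i != 0%N :> nat -> i != n :> nat ->
     (k == 0%N :> nat) || (k == n :> nat) -> v i 0 k = 0) ->
  let L := range (fun i => line (frame_neq0 i vu)) in
  simplex p q L /\ simplex_volume p q L = +oo%E.
Proof.
move=> p0 vneg v0 vl vr L; have [simL [s0 ps0 s0v]] := simplex_range_line vu vneg.
split=> //; have [s [lis n0 ns] ->] := simplex_volume_lift simL.
pose e i := line (frame_neq0 i vu).
have Le i : L (e i) by exists i.
have /choice[c cP] (i : 'I_(n + 1)) : exists c, c != 0 /\ s (e i) = c *: v i.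
  have [k k0 ks] := represents_line (represents_lineP (frame_neq0 i vu)) (lis _ (Le i)).
  by exists k.
have n0' : (0 < n)%N by rewrite addn_gt0 p0.
apply: (@volume_lift_hull_pinfty R p q (Ordinal n0') (s \o e) v c) => //.
- by move=> i; have [] := cP i.
- by move=> i; have [] := cP i.
- by case: simL => _ _ spL; exact: (spanning_frame spL lis erefl).
- by move=> i j; exact: ns.
- rewrite v0// -!basis_vecE /=; congr (_ + basis_vec _); exact/esym/addn0.
- rewrite (vl (rshift n ord0) (addn0 n)) -!basis_vecE /=; congr (_ + basis_vec _); exact/esym/addn0.
- move=> i ii0 iil; split; apply: vr => //=; rewrite ?addn0 ?eqxx ?orbT//.
    by apply: contra_neq iil => iE; apply/val_inj; rewrite /= addn0.
  by apply: contra_neq iil => iE; apply/val_inj; rewrite /= addn0.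
- by rewrite image_comp.
Qed.

Lemma comb_submx m (M : 'M[R]_(m, n + 1)) (a b : R) (x y : V) :
  (x <= M)%MS -> (y <= M)%MS -> ((a *: x + b *: y)%R <= M)%MS.
Proof. by move=> xM yM; apply: addmx_sub; exact: scalemx_sub. Qed.

(** The vertices 0 and [n] are the isotropic vectors e_n + e_0 and e_n - e_0, of product -2; [w]
    supplies a basis of the orthogonal complement of their plane. The last hypothesis expresses that
    [w] spans it, in a form suited to elimination. *)
Lemma exists_simplex_pinfty (w : nat -> V) : (0 < p)%N ->
  (forall k (i : 'I_(n + 1)), (0 < k < n)%N -> (i == 0%N :> nat) || (i == n :> nat) ->
    w k 0 i = 0) ->
  (forall k l, (0 < k < n)%N -> (0 < l < n)%N -> form (w k) (w l) <= 0) ->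
  (forall M : 'M[R]_(n + 1), (forall k, (0 < k < n)%N -> (w k <= M)%MS) ->
    forall k, (0 < k < n)%N -> ((bv k) <= M)%MS) ->
  exists L : set (proj_space R (n + 1)), [/\ simplex p q L, simplex_volume p q L = +oo%E &
    ideal p q L <-> forall k, (0 < k < n)%N -> form (w k) (w k) = 0].
Proof.
move=> p0 w0 wneg wspan.
pose v (i : 'I_(n + 1)) : V :=
  if i == 0%N :> nat then (bv 0) + (bv n) else if i == n :> nat then - (bv 0) + (bv n) else w i.
have h0 : (0 < n + 1)%N by lia.
have hn : (n < n + 1)%N by lia.
have v0 (i : 'I_(n + 1)) : i = 0%N :> nat -> v i = (bv 0) + (bv n) by move=> i0; rewrite /v i0.
have nn0 : (n == 0)%N = false by lia.
have vn (i : 'I_(n + 1)) : i = n :> nat -> v i = - (bv 0) + (bv n).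
  by move=> i0; rewrite /v i0 nn0 eqxx.
have vw (i : 'I_(n + 1)) : (0 < i < n)%N -> v i = w i.
  by move=> i0; rewrite /v !ifF//; lia.
have icase (i : 'I_(n + 1)) : [\/ i = 0%N :> nat, i = n :> nat | (0 < i < n)%N].
  have := ltn_ord i => hi; have [->|i0] := eqVneq (i : nat) 0%N; first exact: Or31.
  by have [->|i1] := eqVneq (i : nat) n; [exact: Or32|apply: Or33; lia].
have et0 : eta p 0 = 1 :> R by rewrite /eta p0.
have etn : eta p n = -1 :> R by rewrite /eta ifN// -leqNgt leq_addr.
have fe (k : nat) (x : V) (hk : (k < n + 1)%N) : form (bv k) x = eta p k * x 0 (Ordinal hk).
  by rewrite (basis_vecE (Ordinal hk)) form_delta.
have form0 (x : V) : form ((bv 0) + (bv n)) x = x 0 (Ordinal h0) - x 0 (Ordinal hn).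
  by rewrite formDl !fe et0 etn; ring.
have formn (x : V) : form (- (bv 0) + (bv n)) x = - x 0 (Ordinal h0) - x 0 (Ordinal hn).
  by rewrite formDl formNl !fe et0 etn; ring.
have addE (x y : V) i : (x + y) 0 i = x 0 i + y 0 i by rewrite mxE.
have oppE (x : V) i : (- x) 0 i = - x 0 i by rewrite mxE.
have b00 : bv 0 0 (Ordinal h0) = 1 by rewrite mxE.
have b0n : bv 0 0 (Ordinal hn) = 0 by rewrite mxE /= eq_sym nn0.
have bn0 : bv n 0 (Ordinal h0) = 0 by rewrite mxE /= nn0.
have bnn : bv n 0 (Ordinal hn) = 1 by rewrite mxE /= eqxx.
have vneg i j : form (v i) (v j) <= 0.
  wlog : i j / (i <= j)%N.
    by move=> H; case/orP: (leq_total i j) => ij; [|rewrite formC]; exact: H.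
  have [i0|i_n|iw] := icase i; have [j0|jn|jw] := icase j => ij; try lia;
    rewrite ?(v0 _ i0) ?(v0 _ j0) ?(vn _ i_n) ?(vn _ jn) ?(vw _ iw) ?(vw _ jw) ?form0 ?formn;
    try (by rewrite !addE ?oppE b00 b0n bn0 bnn; lra).
  - by rewrite !w0 ?eqxx ?orbT//= subr0.
  - by rewrite formC formn !w0 ?eqxx ?orbT//= oppr0 subr0.
  - exact: wneg.
have vu : frame_mx v \in unitmx.
  have sub_v i : (v i <= frame_mx v)%MS by rewrite -[v i]rowK row_sub.
  have sub_w k : (0 < k < n)%N -> (w k <= frame_mx v)%MS.
    move=> k0; have kn : (k < n + 1)%N by lia.
    by rewrite -(vw (Ordinal kn) k0).
  have vs0 := sub_v (Ordinal h0); rewrite (v0 (Ordinal h0) erefl) in vs0.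
  have vsn := sub_v (Ordinal hn); rewrite (vn (Ordinal hn) erefl) in vsn.
  apply: frame_mx_unit_basis => k; have [->|->|kw] := icase k.
  - have -> : (bv 0) = 2^-1 *: ((bv 0) + (bv n)) + (- 2^-1) *: (- (bv 0) + (bv n)).
      by apply/rowP => j; rewrite !mxE; field.
    exact: comb_submx.
  - have -> : (bv n) = 2^-1 *: ((bv 0) + (bv n)) + 2^-1 *: (- (bv 0) + (bv n)).
      by apply/rowP => j; rewrite !mxE; field.
    exact: comb_submx.
  - exact: wspan.
have [i k i0 i_n kk|simL volL] := simplex_pinfty vu p0 vneg v0 vn.
  have iw : (0 < i < n)%N by move: (ltn_ord i) i0 i_n; lia.
  by rewrite vw// w0.
exists (range (fun i => line (frame_neq0 i vu))); split=> //.
rewrite ideal_rangeP; split=> [idv k k0|idw i].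
  have kn : (k < n + 1)%N by lia.
  by rewrite -(vw (Ordinal kn) k0).
have [i0|i_n|iw] := icase i; rewrite ?(v0 _ i0) ?(vn _ i_n) ?(vw _ iw) ?form0 ?formn ?idw//;
  by rewrite !addE ?oppE b00 b0n bn0 bnn; lra.
Qed.

Let formDZ := (@formDl R p q, @formDr R p q, @formZl R p q, @formZr R p q).

(** The negative vector e_p is taken as a vertex, which excludes ideality; q > 0 puts its index
    strictly between 0 and n. The term 2 e_p in the other vertices contributes -4 to their products,
    against at most 1 from e_k. *)
Lemma exists_non_ideal_simplex_pinfty : (0 < p)%N -> (0 < q)%N ->
  exists L : set (proj_space R (n + 1)), [/\ simplex p q L, ~ ideal p q L & simplex_volume p q L = +oo%E].
Proof.
move=> p0 q0.
pose w k : V := if k == p then (bv p) else 2 *: (bv p) + (bv k).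
have etp : eta p p = -1 :> R by rewrite /eta ltnn.
have hp : (p < n + 1)%N by lia.
have [||M wM k k0|L [sL vL iL]] := exists_simplex_pinfty (w := w) p0.
- move=> k i k0 i0; have [e1 e2] : (p == i)%N = false /\ (k == i)%N = false.
    by case/orP: i0 => /eqP->; split; lia.
  by rewrite /w; case: ifP => _; rewrite !mxE ?e1 ?e2 ?mulr0n; ring.
- move=> k l k0 l0; rewrite /w; have hk : (k < n + 1)%N by lia.
  have ek : eta p k <= 1 :> R by rewrite /eta; case: ifP => _; lra.
  case: (eqVneq k p) => kp; case: (eqVneq l p) => lp;
    rewrite ?formDZ !form_basis_vec// !eqxx etp.
  + by rewrite mulr1n; lra.
  + by rewrite eq_sym (negbTE lp) mulr0n mulr1n; lra.
  + by rewrite (negbTE kp) mulr0n mulr1n; lra.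
  + by rewrite (negbTE kp) (eq_sym p) (negbTE lp); case: (k == l); rewrite ?mulr0n ?mulr1n; lra.
- have wp := wM p; rewrite /w eqxx in wp.
  have {}wp : ((bv p) <= M)%MS by apply: wp; lia.
  have := wM k k0; rewrite /w; case: eqVneq => [->//|kp] wk.
  have -> : (bv k) = 1 *: (2 *: (bv p) + (bv k)) + (- 2) *: (bv p).
    by apply/rowP => j; rewrite !mxE; ring.
  exact: comb_submx.
exists L; split=> // /iL /(_ p); rewrite /w eqxx form_basis_vec// eqxx etp.
have pn : (0 < p < n)%N by lia.
by move=> /(_ pn); rewrite mulr1n; lra.
Qed.

Lemma exists_ideal_simplex_pinfty : (3 <= p)%N -> (0 < q)%N ->
  exists L : set (proj_space R (n + 1)), [/\ simplex p q L, ideal p q L & simplex_volume p q L = +oo%E].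
Proof.
move=> p3 q0.
(* a = e_p - e_1 and b = e_p + e_1 are isotropic and b(a, b) = -2, hence
   z |-> a + z + (Q z / 4) b is isotropic, with products -Q(z - z') / 2; the
   points z_k = 2k e_2 + e_k (and z_2 = 4 e_2) are spacelike separated. *)
pose u (x1 xp x2 y : R) (k : nat) : V := x1 *: (bv 1) + xp *: (bv p) + (x2 *: (bv 2) + y *: (bv k)).
have et1 : eta p 1 = 1 :> R by rewrite /eta ifT//; lia.
have et2 : eta p 2 = 1 :> R by rewrite /eta ifT//; lia.
have etp : eta p p = -1 :> R by rewrite /eta ltnn.
have hp : (p < n + 1)%N by lia.
have h1 : (1 < n + 1)%N by lia.
have h2 : (2 < n + 1)%N by lia.
have form_u x1 xp x2 y k x1' xp' x2' y' l : (k < n + 1)%N ->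
    (k != 1%N) && (k != p) || (y == 0) -> (k != 2%N) || (y == 0) ->
    (l != 1%N) && (l != p) || (y' == 0) -> (l != 2%N) || (y' == 0) ->
    form (u x1 xp x2 y k) (u x1' xp' x2' y' l) =
    x1 * x1' - xp * xp' + x2 * x2' + y * y' * (eta p k * (k == l)%:R).
  move=> kn c1 c2 c3 c4.
  have s1 : (1 == p)%N = false by lia.
  have s2 : (p == 1)%N = false by lia.
  have s3 : (2 == p)%N = false by lia.
  have s4 : (p == 2)%N = false by lia.
  have yk m : (m == 1)%N || (m == 2)%N || (m == p) -> y * (k == m)%:R = 0.
    move=> mm; case: (eqVneq k m) => [km|_]; last by rewrite mulr0n mulr0.
    have /eqP-> : y == 0 by move: mm c1 c2; rewrite km; case: (y == 0) => //; lia.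
    by rewrite mul0r.
  have yl m : (m == 1)%N || (m == 2)%N || (m == p) -> y' * (m == l)%:R = 0.
    move=> mm; case: (eqVneq m l) => [km|_]; last by rewrite mulr0n mulr0.
    have /eqP-> : y' == 0 by move: mm c3 c4; rewrite km; case: (y' == 0) => //; lia.
    by rewrite mul0r.
  rewrite /u !formDZ !form_basis_vec// !eqxx s1 s2 s3 s4 et1 et2 etp /=.
  have := yk 1%N isT; have := yk 2%N isT; have := yk p _; rewrite eqxx !orbT => /(_ isT).
  have := yl 1%N isT; have := yl 2%N isT; have := yl p _; rewrite eqxx !orbT => /(_ isT).
  set b1 := (k == 1%N)%:R; set b2 := (k == 2%N)%:R; set b3 := (k == p)%:R.
  set d1 := (1%N == l)%:R; set d2 := (2%N == l)%:R; set d3 := (p == l)%:R.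
  set e := eta p k; set kl := (k == l)%:R.
  move=> f1 f2 f3 f4 f5 f6; rewrite !mulr0n !mulr1n.
  (* The added terms vanish by [f1], ..., [f6] and are the cross terms of the expansion, after which
     the identity is polynomial. *)
  have -> : x1 * x1' - xp * xp' + x2 * x2' + y * y' * (e * kl) =
      x1 * x1' - xp * xp' + x2 * x2' + y * y' * (e * kl) +
      (x1 * (y' * d1) - xp * (y' * d3) + x2 * (y' * d2)) +
      ((y * b1) * (x1' * e) + (y * b3) * (xp' * e) + (y * b2) * (x2' * e)).
    by rewrite f1 f2 f3 f4 f5 f6; ring.
  by ring.
pose dl (k : nat) : R := (k != 2%N)%:R.
pose Q (k : nat) : R := 4 * k%:R ^+ 2 + dl k * eta p k.
(* Index [p] gives b, the point at infinity, and index 1 gives a, the point z = 0. Otherwise the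
   coefficients of e_1 and e_p are those of a + (Q / 4) b. *)
pose w k : V := if k == p then u 1 1 0 0 k else if k == 1%N then u (-1) 1 0 0 k else
  u (-1 + Q k / 4) (1 + Q k / 4) (2 * k%:R) (dl k) k.
have dl2 k : (k != 2%N) || (dl k == 0) by rewrite /dl; case: eqVneq => //=; rewrite mulr0n eqxx.
have dl01 k : dl k = 0 \/ dl k = 1 by rewrite /dl; case: (_ != _); [right|left].
have ete k : -1 <= eta p k :> R /\ eta p k <= 1 :> R by rewrite /eta; case: ifP => _; split; lra.
have Q0 k : (0 < k)%N -> 0 < Q k.
  move=> k0; have : 1 <= k%:R :> R by rewrite ler1n.
  by have [e1 e2] := ete k; rewrite /Q; case: (dl01 k) => ->; nra.
have formw k l : (0 < k < n)%N -> (0 < l < n)%N ->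
    form (w k) (w l) <= 0 /\ (k = l -> form (w k) (w l) = 0).
  move=> k0 l0; have hk : (k < n + 1)%N by lia.
  have Qk : 0 < Q k by apply: Q0; lia.
  have Ql : 0 < Q l by apply: Q0; lia.
  rewrite /w; case: (eqVneq k p) => kp; [|case: (eqVneq k 1%N) => k1];
    (case: (eqVneq l p) => lp; [|case: (eqVneq l 1%N) => l1]);
    rewrite form_u ?eqxx ?orbT// ?kp ?k1 ?lp ?l1//; split;
    try (by lra); try (by move=> kl; lra); try (by move=> kl; lia).
  - have [e1 e2] := ete k; have [e3 e4] := ete l.
    have [kl|kl] := eqVneq k l.
      by rewrite kl /Q mulr1n; case: (dl01 l) => ->; lra.
    (* Here Q(z_k - z_l) is 4 (k - l)^2 plus one term >= -1 for each of e_k and e_l, hence at least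
       2; this is the reason for the factor 2 in 2 k e_2. *)
    have kl2 : 1 <= (k%:R - l%:R) ^+ 2 :> R.
      have [ltkl|ltlk|//] := ltngtP k l; last by move=> E; rewrite E eqxx in kl.
        have : k%:R + 1 <= l%:R :> R by rewrite natr1 ler_nat.
        nra.
      have : l%:R + 1 <= k%:R :> R by rewrite natr1 ler_nat.
      nra.
    by rewrite /Q mulr0n; case: (dl01 l) => ->; case: (dl01 k) => ->; nra.
  - by move=> kl; rewrite kl eqxx mulr1n /Q; case: (dl01 l) => ->; lra.
have [||k l k0 l0|M wM k k0|L [sL vL iL]] := exists_simplex_pinfty (w := w) _.
- by lia.
- move=> k i k0 i0; have [e1 e2] : (p == i)%N = false /\ (k == i)%N = false.
    by case/orP: i0 => /eqP->; split; lia.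
  have [e3 e4] : (1 == i)%N = false /\ (2 == i)%N = false.
    by case/orP: i0 => /eqP->; split; lia.
  by rewrite /w /u; case: ifP => _; [|case: ifP => _]; rewrite !mxE ?e1 ?e2 ?e3 ?e4 ?mulr0n; ring.
- by have [] := formw k l k0 l0.
- have p1 : (1 == p)%N = false by lia.
  have p2 : (2 == p)%N = false by lia.
  have wp := wM p; rewrite /w eqxx in wp.
  have {}wp : (u 1 1 0 0 p <= M)%MS by apply: wp; lia.
  have w1 := wM 1%N; rewrite /w p1 eqxx in w1.
  have {}w1 : ((u (-1) 1 0 0 1)%R <= M)%MS by apply: w1; lia.
  have s1 : (bv 1 <= M)%MS.
    have -> : bv 1 = 2^-1 *: u 1 1 0 0 p + (- 2^-1) *: u (-1) 1 0 0 1.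
      by apply/rowP => j; rewrite !mxE; field.
    exact: comb_submx.
  have sp : (bv p <= M)%MS.
    have -> : bv p = 2^-1 *: u 1 1 0 0 p + 2^-1 *: u (-1) 1 0 0 1.
      by apply/rowP => j; rewrite !mxE; field.
    exact: comb_submx.
  have w2 := wM 2%N; rewrite /w p2 /= in w2.
  have {}w2 : ((u (-1 + Q 2 / 4) (1 + Q 2 / 4) (2 * 2) (dl 2) 2)%R <= M)%MS by apply: w2; lia.
  have s2 : (bv 2 <= M)%MS.
    have -> : bv 2 = 4^-1 *: (1 *: u (-1 + Q 2 / 4) (1 + Q 2 / 4) (2 * 2) (dl 2) 2 + (1 - Q 2 / 4) *: bv 1)
         + (- ((1 + Q 2 / 4) / 4)) *: bv p.
      have d2 : dl 2 = 0 by rewrite /dl eqxx.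
      by apply/rowP => j; rewrite !mxE d2; field.
    by apply: comb_submx => //; exact: comb_submx.
  have [->//|kp] := eqVneq k p.
  have [->//|k1] := eqVneq k 1%N.
  have [->//|k2] := eqVneq k 2%N.
  have := wM k k0; rewrite /w (negbTE kp) (negbTE k1) => wk.
  have -> : bv k = 1 *: (1 *: u (-1 + Q k / 4) (1 + Q k / 4) (2 * k%:R) (dl k) k + (1 - Q k / 4) *: bv 1)
      + 1 *: ((- (1 + Q k / 4)) *: bv p + (- (2 * k%:R)) *: bv 2).
    have dk : dl k = 1 by rewrite /dl k2.
    by apply/rowP => j; rewrite !mxE dk; field.
  by apply: comb_submx; exact: comb_submx.
exists L; split=> //; apply/iL => k k0; have [_] := formw k k k0 k0; exact.
Qed.
End simplices_of_infinite_volume.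

(** * The region of a 5-cycle *)

(** The bounds form an n-fold geometric series, summed one index at a time by countable
    subadditivity. With [c = 0] it shows that a countable union of null sets is null. *)
Lemma measure_bigcup_geometric d (T : measurableType d) (R : realType)
    (mu : {measure set T -> \bar R}) n (F : n.-tuple nat -> set T) (c q : R) :
  0 <= c -> 0 < q -> q < 1 -> (forall m, measurable (F m)) ->
  (forall m, mu (F m) <= (c * q ^+ (\sum_(i < n) tnth m i))%:E)%E ->
  measurable (\bigcup_m F m) /\
  (mu (\bigcup_m F m) <= (c * (1 - q)^-1 ^+ n)%:E)%E.
Proof.
move=> + q0 q1; elim: n F c => [|n IH] F c c0 mF Fle.
  have -> : \bigcup_m F m = F [tuple].
    apply/seteqP; split => [x [m _]|x Fx]; last by exists [tuple].
    by rewrite [m]tuple0.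
  by split=> //; rewrite expr0 -(expr0 q); have := Fle [tuple]; rewrite big_ord0.
pose G (a : nat) := \bigcup_(m : n.-tuple nat) F [tuple of a :: m].
have mG a : measurable (G a) /\ (mu (G a) <= (c * q ^+ a * (1 - q)^-1 ^+ n)%:E)%E.
  apply: IH; [by rewrite mulr_ge0// exprn_ge0// ltW|by move=> m; exact: mF|move=> m].
  have := Fle [tuple of a :: m]; rewrite big_ord_recl tnth0 exprD mulrA.
  by under eq_bigr do rewrite tnthS.
have GE : \bigcup_m F m = \bigcup_a G a.
  apply/seteqP; split => [x [m _ Fx]|x [a _ [m _ Fx]]]; last by exists [tuple of a :: m].
  by exists (thead m) => //; exists [tuple of behead m] => //; rewrite -tuple_eta.
have mUG : measurable (\bigcup_a G a) by apply: bigcup_measurable => a _; exact: (mG a).1.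
rewrite GE; split=> //.
have := measure_sigma_subadditive mu (fun a => (mG a).1) mUG (@subset_refl _ _).
move=> /le_trans; apply; apply: lime_le.
  by apply: is_cvg_nneseries => a _ _; exact: measure_ge0.
apply: nearW => N.
apply: (@le_trans _ _ (\sum_(0 <= a < N) (c * q ^+ a * (1 - q)^-1 ^+ n)%:E)%E).
  by apply: lee_sum => a _; exact: (mG a).2.
rewrite sumEFin lee_fin.
under eq_bigr do rewrite mulrAC.
have c1 : 0 <= c * (1 - q)^-1 ^+ n; last first.
  by rewrite exprSr mulrA; apply: (geometric_le_lim N c1 q0); rewrite ger0_norm// ltW.
by rewrite mulr_ge0// exprn_ge0// invr_ge0 subr_ge0 ltW.
Qed.

Section five_cycle.
Context {R : realType}.
Implicit Types (t : 5.-tuple R) (i : 'I_5).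

Definition five_cycle_region : set (5.-tuple R) :=
  [set t | forall i, `|tnth t i * tnth t (i + 1)| <= 1].

Lemma measurable_five_cycle_region : measurable five_cycle_region.
Proof.
pose f i t := `|tnth t i * tnth t (i + 1)|.
have mf i : measurable_fun setT (f i).
  apply: measurableT_comp => //; apply: measurable_funM.
    exact: (@measurable_tnth _ R 5 i).
  exact: (@measurable_tnth _ R 5 (i + 1)).
rewrite (_ : five_cycle_region = \bigcap_(i in setT) (f i @^-1` `]-oo, 1]%classic)).
  by apply: fin_bigcap_measurable => // i _; exact: preimageT_measurable.
apply/seteqP; split => t tW i; first by move=> _; rewrite /= in_itv /=; exact: tW.
by have := tW i I; rewrite /= in_itv.
Qed.

Lemma lebesgue_coord0 n (i : 'I_n) : lebesgue_tuple R n [set t | tnth t i = 0] = 0%E.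
Proof.
pose B j : set R := if j == i then [set 0] else setT.
have mB j : measurable (B j) by rewrite /B; case: ifP => _; [exact: measurable_set1|].
rewrite (_ : [set _ | _] = [set t | forall j, B j (tnth t j)]).
  by rewrite lebesgue_box// (bigD1 i)//= {1}/B eqxx lebesgue_measure_set1 mul0e.
apply/seteqP; split => t /= tB; last by have := tB i; rewrite /B eqxx.
by move=> j; rewrite /B; case: eqVneq => // ->.
Qed.

(* With u_i = ln |t_i| and s_i = -(u_i + u_(i+1)) >= 0, the fact that 5 is odd
   allows one to solve for u_i: the alternating sum of s_i, ..., s_(i+4) is
   -2 u_i. The cells are indexed by the integer parts m_i of the s_i. *)
Let alt (m : 5.-tuple nat) i : R := (tnth m i)%:R - (tnth m (i + 1))%:R +
  (tnth m (i + 2))%:R - (tnth m (i + 3))%:R + (tnth m (i + 4))%:R.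

Let sum_alt m : \sum_i alt m i = (\sum_i tnth m i)%:R.
Proof.
have sh (k : 'I_5) : \sum_i (tnth m (i + k))%:R = (\sum_i tnth m i)%:R :> R.
  by rewrite natr_sum [RHS](reindex_inj (addIr k)).
rewrite /alt !big_split /= !sumrN !sh -natr_sum; ring.
Qed.

(** Passing from s to its integer parts changes each term by less than 1; the two terms of negative
    sign can make the alternating sum of s smaller than [alt m i] by at most 2, whence u_i <= 1 -
    alt / 2. *)
Let side m i : set R := `[- expR (1 - alt m i / 2), expR (1 - alt m i / 2)]%classic.

Let cell m : set (5.-tuple R) := [set t | forall i, side m i (tnth t i)].

(** Each entry of [m] has total coefficient 3 - 2 = 1 in the five alternating sums, so the measures
    decay geometrically in the sum of [m]. *)
Let leb_cell m :
  lebesgue_tuple R 5 (cell m) = ((2 * expR 1) ^+ 5 * expR (- 2^-1) ^+ (\sum_(i < 5) tnth m i))%:E.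
Proof.
rewrite (@lebesgue_box R 5 (side m)); last by move=> i; exact: measurable_itv.
rewrite (eq_bigr (fun i => (2 * expR 1 * expR (- (alt m i / 2)))%:E)); last first.
  move=> i _; rewrite lebesgue_measure_itv /= lte_fin.
  have e0 := @expR_gt0 R (1 - alt m i / 2).
  by rewrite ifT; [rewrite -EFinB -mulrA -expRD opprK mulr_natl mulr2n|lra].
rewrite prodEFin big_split /= prodr_const card_ord -expR_sum; congr (_ * _)%:E.
rewrite -expRM_natl; congr expR.
by rewrite sumrN -mulr_suml sum_alt mulrN.
Qed.

Let region_cover : five_cycle_region `<=`
  (\bigcup_m cell m) `|` \bigcup_(m : 1.-tuple nat) [set t | tnth t (inord (thead m)) = 0].
Proof.
move=> t tW; case: (pselect (exists i, tnth t i = 0)) => [[i ti0]|tn0].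
  by right; exists [tuple (i : nat)] => //=; rewrite inord_val.
left.
have t0 i : 0 < `|tnth t i| by rewrite normr_gt0; apply/eqP => ti; apply: tn0; exists i.
pose u i := ln `|tnth t i|.
pose s i := - (u i + u (i + 1)).
have s0 i : 0 <= s i.
  rewrite /s /u oppr_ge0 -lnM ?posrE//; apply: ln_le0.
  by rewrite -normrM; exact: tW.
exists [tuple Num.truncn (s i) | i < 5] => // i /=.
have ms j : (Num.truncn (s j))%:R <= s j /\ s j < (Num.truncn (s j))%:R + 1.
  by have /andP[h1 h2] := truncn_itv (s0 j); rewrite natr1.
rewrite /side /= in_itv /= -ler_norml -[X in X <= _](lnK _) ?posrE// ler_expR -/(u i).
rewrite /alt !tnth_mktuple.
have [h0 h0'] := ms i; have [h1 h1'] := ms (i + 1); have [h2 h2'] := ms (i + 2).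
have [h3 h3'] := ms (i + 3); have [h4 h4'] := ms (i + 4).
have E2 : i + 1 + 1 = i + 2 by rewrite -addrA.
have E3 : i + 2 + 1 = i + 3 by rewrite -addrA; congr (_ + _); exact/val_inj.
have E4 : i + 3 + 1 = i + 4 by rewrite -addrA; congr (_ + _); exact/val_inj.
have E5 : i + 4 + 1 = i.
  by rewrite -addrA (_ : 4 + 1 = 0) ?addr0//; exact/val_inj.
have uE : u i = - (s i - s (i + 1) + s (i + 2) - s (i + 3) + s (i + 4)) / 2.
  by rewrite /s E2 E3 E4 E5; field.
rewrite uE; lra.
Qed.

Lemma lebesgue_five_cycle_region : (lebesgue_tuple R 5 five_cycle_region < +oo)%E.
Proof.
pose q : R := expR (- 2^-1).
have q0 : 0 < q by exact: expR_gt0.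
have q1 : q < 1 by rewrite /q -expR0 ltr_expR oppr_lt0 invr_gt0.
have c0 : 0 <= (2 * expR 1) ^+ 5 :> R by rewrite exprn_ge0// mulr_ge0// expR_ge0.
have mcell m : measurable (cell m) by apply: (@measurable_box R 5 (side m)) => i; exact: measurable_itv.
have [|mU Ule] := measure_bigcup_geometric (mu := lebesgue_tuple R 5) c0 q0 q1 mcell.
  by move=> m; rewrite [leLHS]leb_cell lexx.
(* [inord] sends the indices above 4 to 0, so these are just the five coordinate hyperplanes,
   indexed so as to reuse the same summation lemma. *)
pose Z (m : 1.-tuple nat) : set (5.-tuple R) := [set t | tnth t (inord (thead m)) = 0].
have mZ m : measurable (Z m).
  rewrite (_ : Z m = (@tnth 5 R ^~ (inord (thead m))) @^-1` [set 0])//.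
  exact: (preimageT_measurable (@measurable_tnth _ (measurableTypeR R) 5 _) (measurable_set1 0)).
have [|mUZ UZle] := measure_bigcup_geometric (mu := lebesgue_tuple R 5) (lexx 0) q0 q1 mZ.
  by move=> m; rewrite mul0r [leLHS]lebesgue_coord0 lexx.
have mW := measurable_five_cycle_region.
apply: (@le_lt_trans _ _ (lebesgue_tuple R 5 ((\bigcup_m cell m) `|` \bigcup_m Z m))).
  by apply: le_measure region_cover; rewrite inE//; exact: measurableU.
apply: le_lt_trans (measureU2 _ mU mUZ) _.
apply: le_lt_trans (leeD Ule UZle) _.
by rewrite -EFinD ltry.
Qed.

End five_cycle.

(** * Integrals over cones *)

Section integral_cone.
Context {R : realType}.
Local Notation leb n := (lebesgue_tuple R n).
Local Notation dilate r := (map_tuple (fun x => r * x)).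

Lemma measurable_ctuple_scale n : measurable_fun setT
  (fun z : measurableTypeR R * n.-tuple R => ctuple z.1 (dilate z.1 z.2)).
Proof.
apply: measurable_cons; first exact: measurable_fst.
apply/measurable_fun_tnthP => i.
rewrite (_ : _ \o _ = fun z : measurableTypeR R * n.-tuple R => (z.1 : R) * tnth z.2 i).
  apply: measurable_funM; first exact: measurable_fst.
  exact: (measurableT_comp (@measurable_tnth _ R n i) measurable_snd).
by apply/funext => z /=; rewrite tnth_map.
Qed.

(* N^(-(n+1)/2) is up to a constant the integral of r^n over 0 < r < N^(-1/2), so
   the integral compares with the measure of a part of a cone over D. *)
Lemma integral_cone_lt_pinfty n (D : set (n.-tuple R)) (N : n.-tuple R -> R)
    (M : 'M[R]_n.+1) (W : set (n.+1.-tuple R)) :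
  M \in unitmx -> measurable W -> (leb n.+1 W < +oo)%E ->
  (forall t, D t -> 0 < N t) ->
  (forall t r, D t -> 0 < r -> r ^+ 2 * N t <= 1 -> W (linT M (ctuple r (dilate r t)))) ->
  (\int[leb n]_(t in D) (Num.sqrt (N t ^- n.+1))%:E < +oo)%E.
Proof.
move=> Mu mW Woo N0 DW.
pose LW := linT M @^-1` W.
have mLW : measurable LW by exact: preimageT_measurable (measurable_linT M) mW.
have [C [C0 _ domC]] := dominated_linT Mu.
have LWoo : (leb n.+1 LW < +oo)%E.
  by apply: le_lt_trans (domC _ mW) _; rewrite lte_mul_pinfty// ?lee_fin.
(* [E] is built from [W] alone, which makes it measurable whatever [D] is; by [DW] it contains (r,
   t) for t in [D] and 0 < r <= N(t)^(-1/2). *)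
pose E : set (measurableTypeR R * n.-tuple R) :=
  [set z | 0 < (z.1 : R) /\ LW (ctuple z.1 (dilate z.1 z.2))].
have mE : measurable E.
  rewrite (_ : E = (fst @^-1` `]0, +oo[%classic) `&`
     ((fun z : measurableTypeR R * n.-tuple R => ctuple z.1 (dilate z.1 z.2)) @^-1` LW)).
    apply: measurableI; last exact: preimageT_measurable (@measurable_ctuple_scale n) mLW.
    exact: (preimageT_measurable (@measurable_fst _ _ (measurableTypeR R) _)).
  by apply/seteqP; split => -[r t] /=; rewrite in_itv /= andbT.
pose f (z : measurableTypeR R * n.-tuple R) : \bar R := (((z.1 : R) ^+ n) * \1_E z)%:E.
have f0 z : (0 <= f z)%E.
  rewrite /f lee_fin indicE; case: (boolP (z \in E)) => [/set_mem[z0 _]|_]; last by rewrite mulr0.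
  by rewrite mulr1 exprn_ge0// ltW.
have mf : measurable_fun setT f.
  apply/measurable_EFinP; apply: measurable_funM; last exact: measurable_indic.
  apply: (measurable_funX (f := fun z : measurableTypeR R * n.-tuple R => (z.1 : R))).
  exact: (@measurable_fst _ _ (measurableTypeR R) (n.-tuple R)).
pose g t := (\int[lebesgue_measure]_r f (r, t))%E.
have g0 t : (0 <= g t)%E by exact: integral_ge0.
have mg : measurable_fun setT g.
  exact: (measurable_fun_fubini_tonelli_G (m1 := @lebesgue_measure R) f mf f0).
(* The weight [r ^+ n] is the Jacobian of the dilation of the tail by [r]. *)
have fint (r : R) : (\int[leb n]_t f (r, t) <= leb n (ctuple r @^-1` LW))%E.
  have [r0|r0] := ltP 0 r; last first.
    rewrite integral0_eq// => t _; rewrite /f indicE memNset ?mulr0// => -[/=].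
    by rewrite ltNge r0.
  have mS : measurable (ctuple r @^-1` LW) by exact: preimageT_measurable (measurable_ctuple r) mLW.
  have mS' : measurable (dilate r @^-1` (ctuple r @^-1` LW)).
    have -> : dilate r @^-1` (ctuple r @^-1` LW) = xsection E r.
      apply/seteqP; split => t; rewrite /xsection /= inE; first by [].
      by case.
    exact: measurable_xsection.
  rewrite (eq_integral (fun t => ((r ^+ n)%:E * (\1_(dilate r @^-1` (ctuple r @^-1` LW)) t)%:E)%E)).
    rewrite ge0_integralZl//; last 2 first.
    - by apply/measurable_EFinP; exact: measurable_indic.
    - by rewrite lee_fin exprn_ge0// ltW.
    rewrite integral_indic ?setIT// [X in (_ * X)%E](lebesgue_scale r0 mS).
    by rewrite muleA -EFinM mulfV ?mul1e// expf_neq0// gt_eqF.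
  move=> t _; rewrite /f -EFinM /=; congr (_ * _)%:E; rewrite !indicE; congr (_%:R).
  congr nat_of_bool; apply/idP/idP; rewrite !inE /E /=; first by case.
  by [].
have gint : (\int[leb n]_t g t < +oo)%E.
  rewrite -(fubini_tonelli f mf f0).
  apply: le_lt_trans LWoo; rewrite lebesgue_tupleS.
  apply: ge0_le_integral_nomeas => //.
  by move=> r; exact: integral_ge0.
(* On [h / 2, h] with h = N(t)^(-1/2), the weight is at least (h / 2)^n, so [g t] is at least (h /
   2)^(n + 1); this crude bound costs only the factor 2^(n + 1). *)
apply: (@le_lt_trans _ _ (\int[leb n]_t ((2 ^+ n.+1)%:E * g t))%E); last first.
  rewrite ge0_integralZl//.
  by rewrite lte_mul_pinfty// lee_fin exprn_ge0.
rewrite integral_mkcond; apply: ge0_le_integral_nomeas.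
  move=> t; rewrite patchE; case: ifP => // _; rewrite lee_fin; exact: sqrtr_ge0.
move=> t; rewrite patchE; case: ifPn => [/set_mem Dt|_]; last first.
  by rewrite mule_ge0// lee_fin exprn_ge0.
have Nt := N0 _ Dt; pose h := (Num.sqrt (N t))^-1.
have h0 : 0 < h by rewrite invr_gt0 sqrtr_gt0.
have h2 : h ^+ 2 * N t = 1 by rewrite exprVn sqr_sqrtr ?mulVf ?gt_eqF// ltW.
have -> : Num.sqrt (N t ^- n.+1) = h ^+ n.+1.
  have -> : N t ^- n.+1 = (h ^+ n.+1) ^+ 2.
    by rewrite exprAC (_ : h ^+ 2 = (N t)^-1) ?exprVn// sqr_sqrtr// ltW.
  by rewrite sqrtr_sqr ger0_norm// exprn_ge0// ltW.
have mI : measurable (`[h / 2, h]%classic : set (measurableTypeR R)) by exact: measurable_itv.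
apply: (@le_trans _ _ ((2 ^+ n.+1)%:E *
    (\int[lebesgue_measure]_(r in `[(h / 2)%R, h]) ((h / 2) ^+ n)%:E))%E).
  rewrite integral_cst//= lebesgue_measure_itv /= lte_fin ifT; last by lra.
  rewrite -EFinB -!EFinM lee_fin (_ : h - h / 2 = h / 2); last by field.
  by rewrite -exprSr -exprMn mulrCA mulfV ?mulr1// lexx.
apply: lee_wpmul2l; first by rewrite lee_fin exprn_ge0.
rewrite [leLHS]integral_mkcond; apply: ge0_le_integral_nomeas.
  move=> r; rewrite patchE; case: ifP => // _; rewrite lee_fin exprn_ge0// divr_ge0// ltW//.
move=> r; rewrite patchE; case: ifPn => // /set_mem /=; rewrite in_itv /= => /andP[r1 r2].
have r0 : 0 < r by lra.
rewrite /f indicE mem_set ?mulr1 /=; last first.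
  split=> //; apply: DW => //; rewrite -h2 ler_wpM2r ?(ltW Nt)//.
  by rewrite -subr_ge0 subr_sqr mulr_ge0 ?subr_ge0 ?addr_ge0 ?(ltW h0) ?(ltW r0).
have hn : h / 2 \is Num.nneg by rewrite nnegrE divr_ge0// ltW.
have rn : (r : R) \is Num.nneg by rewrite nnegrE ltW.
by rewrite lee_fin; exact: (@lerXn2r R n (h / 2) r hn rn r1).
Qed.

End integral_cone.

(** * Ideal simplices of H^{2,2} *)

(** Without fixed points every orbit has at least 2 elements, so there are at most 2 orbits;
    evenness on 5 letters makes their number odd. The map [f] runs through the single orbit,
    starting at 0. *)
Lemma even_derangement_cycle (s : {perm 'I_5}) : ~~ odd_perm s -> (forall i, s i != i) ->
  exists2 f : 'I_5 -> 'I_5, injective f & forall k, f (k + 1) = s (f k).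
Proof.
move=> es ds.
have ge2 O : O \in porbits s -> (2 <= #|O|)%N.
  move=> /imsetP[x _ ->]; apply/card_gt1P; exists x, (s x).
  by rewrite porbit_id -{1}(expg1 s) mem_porbit eq_sym ds.
have card_sum : \sum_(O in porbits s) #|O| = 5%N.
  have -> : porbits s = [set orbit 'P <[s]>%g x | x in [set: 'I_5]%SET]%SET.
    by apply/setP => O; apply/imsetP/imsetP => -[x _ ->]; exists x; rewrite ?inE ?porbitE.
  rewrite acts_sum_card_orbit ?cardsT ?card_ord//.
  by apply/actsP => a _ y; rewrite !inE.
have N1 : #|porbits s| = 1%N.
  have le2 : (#|porbits s| * 2 <= 5)%N.
    rewrite -[X in (_ <= X)%N]card_sum -sum_nat_const; exact: leq_sum.
  move: es; rewrite /odd_perm card_ord /= negbK => oN.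
  move: oN le2; case: #|_| => [|[|[|m]]]//; lia.
have c5 : #|porbit s ord0| = 5%N.
  rewrite -[RHS]card_sum.
  have /eqP/cards1P [Y YE] := N1.
  have : porbit s ord0 \in porbits s by exact: imset_f.
  by rewrite YE big_set1 inE => /eqP->.
have it5 : iter 5 s ord0 = ord0 by have := iter_porbit s ord0; rewrite c5.
exists (fun k : 'I_5 => iter k s ord0).
  move=> i j ij; have := uniq_traject_porbit s ord0; rewrite c5 => /uniqP.
  move=> /(_ ord0 i j); rewrite !inE size_traject => /(_ (ltn_ord i) (ltn_ord j)).
  by rewrite !nth_traject// => /(_ ij)/val_inj.
move=> k; have [->|k4] := eqVneq k ord_max.
  by rewrite -iterS it5.
rewrite -iterS; congr (iter _ s ord0) => /=.
move: k4; rewrite -val_eqE /= => k4; rewrite modn_small ?addn1//.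
by have := ltn_ord k; lia.
Qed.

Section ideal_simplices_H22.
Context {R : realType}.
Local Notation d := (2 + 2 + 1)%N.
Local Notation V := 'rV[R]_d.
Implicit Types (v w : 'I_d -> V).

Lemma det_form_mx22 : \det (form_mx R 2 2) = -1.
Proof.
rewrite /form_mx det_diag !big_ord_recl big_ord0 !mxE /=.
by rewrite !mul1r !mulN1r !opprK.
Qed.

(* The matrix A = -Gram has nonnegative entries, a zero diagonal and a positive
   determinant, so an even permutation without fixed points contributes to the
   Leibniz formula; on 5 letters it is a 5-cycle. *)
Lemma gram_five_cycle w : frame_mx w \in unitmx ->
  (forall i j, form (w i) (w j) <= 0) -> (forall i, form (w i) (w i) = 0) ->
  exists2 f : 'I_5 -> 'I_5, injective f & forall k, form (w (f k)) (w (f (k + 1))) < 0.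
Proof.
move=> wu wneg w0.
pose A : 'M[R]_d := -1 *: (frame_mx w *m form_mx R 2 2 *m (frame_mx w)^T).
have AE i j : A i j = - form (w i) (w j).
  rewrite mxE mulN1r /form; congr (- _).
  by rewrite /form_mx !mul_mx_diag !mxE; apply: eq_bigr => k _; rewrite !mxE.
(* The sign (-1)^5 of the scaling cancels the determinant -1 of the form, leaving the square of
   [\det (frame_mx w)]. *)
have detA : 0 < \det A.
  rewrite detZ !det_mulmx det_tr det_form_mx22.
  have -> : (-1) ^+ d = -1 :> R by rewrite -signr_odd expr1.
  rewrite (_ : -1 * _ = \det (frame_mx w) ^+ 2); last by ring.
  by rewrite exprn_even_gt0//= -unitfE -unitmxE.
have [s s0] : exists s : {perm 'I_d}, 0 < (-1) ^+ s * \prod_i A i (s i).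
  case: (pselect (exists s : {perm 'I_d}, 0 < (-1) ^+ s * \prod_i A i (s i))) => // ns.
  move: detA; rewrite ltNge => /negP[]; apply: sumr_le0 => s _.
  by rewrite leNgt; apply/negP => h; apply: ns; exists s.
have A0 i j : 0 <= A i j by rewrite AE oppr_ge0.
have P0 : 0 <= \prod_i A i (s i) by exact: prodr_ge0.
have es : ~~ odd_perm s.
  apply/negP => os; move: s0; rewrite os expr1 mulN1r oppr_gt0 ltNge => /negP; exact.
have Pn0 : \prod_i A i (s i) != 0 by apply: contraTneq s0 => ->; rewrite mulr0 ltxx.
have As i : 0 < A i (s i).
  by rewrite lt_neqAle A0 eq_sym; move/prodf_neq0 : Pn0 => ->.
have [i|f fi fs] := even_derangement_cycle es.
  by apply: contraTneq (As i) => ->; rewrite AE w0 oppr0 ltxx.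
exists f => // k; rewrite fs.
by have := As (f k); rewrite AE oppr_gt0.
Qed.

Lemma form_frame_mx w (t : V) : form (t *m frame_mx w) (t *m frame_mx w) =
  \sum_i \sum_j t 0 i * t 0 j * form (w i) (w j).
Proof.
rewrite mul_frame_mx form_suml; apply: eq_bigr => i _.
by rewrite form_sumr; apply: eq_bigr => j _; rewrite formZl formZr mulrA.
Qed.

Lemma form_frame_mx_ge w (t : V) (i j : 'I_d) : (forall i j, form (w i) (w j) <= 0) ->
  (forall i j, 0 <= t 0 i * t 0 j) ->
  t 0 i * t 0 j * - form (w i) (w j) <= - form (t *m frame_mx w) (t *m frame_mx w).
Proof.
move=> wneg t0; rewrite mulrN lerN2 form_frame_mx (bigD1 i)//= (bigD1 j)//=.
have le0 k l : t 0 k * t 0 l * form (w k) (w l) <= 0 by rewrite mulr_ge0_le0.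
have s1 : \sum_(l | l != j) t 0 i * t 0 l * form (w i) (w l) <= 0.
  by apply: sumr_le0 => l _.
have s2 : \sum_(k | k != i) \sum_l t 0 k * t 0 l * form (w k) (w l) <= 0.
  by apply: sumr_le0 => k _; apply: sumr_le0 => l _.
lra.
Qed.

Lemma exists_five_cycle_frame w : frame_mx w \in unitmx ->
  (forall i j, form (w i) (w j) <= 0) -> (forall i, form (w i) (w i) = 0) ->
  exists v (f : 'I_5 -> 'I_5) l, [/\ frame_mx v \in unitmx, 0 < l,
    (forall i, v i = l *: w (f i)), injective f &
    forall k, form (v k) (v (k + 1)) <= -1].
Proof.
move=> wu wneg w0; have [f fi fneg] := gram_five_cycle wu wneg w0.
pose a k := - form (w (f k)) (w (f (k + 1))).
have a0 k : 0 < a k by rewrite oppr_gt0.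
(* The sum stands in for a maximum: l >= 1 and l >= 1 / a_k give l^2 a_k >= 1. One common factor for
   all vertices leaves the signs of barycentric coordinates unchanged. *)
pose l : R := 1 + \sum_(k < 5) (a k)^-1.
have suma : 0 <= \sum_(k < 5) (a k)^-1 by apply: sumr_ge0 => k _; rewrite invr_ge0 ltW.
have l1 : 1 <= l by rewrite lerDl.
have l0 : 0 < l by exact: lt_le_trans l1.
have la k : (a k)^-1 <= l.
  rewrite /l (bigD1 k)//= addrCA lerDl addr_ge0// sumr_ge0// => j _.
  by rewrite invr_ge0 ltW.
pose v i := l *: w (f i).
exists v, f, l; split => //.
  have -> : frame_mx v = l *: (row_perm (perm fi) (frame_mx w)).
    by apply/matrixP => i j; rewrite !mxE permE.
  by rewrite unitmxZ ?unitfE ?gt_eqF// row_permE unitmx_mul unitmx_perm.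
move=> k; rewrite formZl formZr mulrA -[X in _ * X]opprK mulrN lerN2 -/(a k).
rewrite -ler_pdivrMr// mul1r; apply: le_trans (la k) _.
by rewrite ler_peMr// ltW.
Qed.

Lemma ideal_simplex_volume_lt_pinfty (L : set (proj_space R d)) :
  simplex 2 2 L -> ideal 2 2 L -> (simplex_volume 2 2 L < +oo)%E.
Proof.
move=> simL idL; have [s [lis s0 sneg] ->] := simplex_volume_lift simL.
have [e [ie eL wu]] := simplex_frame simL lis.
have Le i : L (e i) by rewrite -eL; exists i.
have [v [f [l [vu l0 vE fi v1]]]] := exists_five_cycle_frame wu
  (fun i j => sneg _ _ (Le i) (Le j)) (fun i => idL _ (Le i) _ (lis _ (Le i))).
have vneg i j : form (v i) (v j) <= 0.
  rewrite !vE formZl formZr mulrA pmulr_rle0 ?mulr_gt0//; exact: sneg.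
have sw : s @` L = range (s \o e) by rewrite -eL image_comp.
pose B := invmx (frame_mx v).
(* The radial variable comes first in the cone (r, r t), while [affine_point] has its 1 last; [Sw]
   exchanges the two blocks. *)
pose Sw : 'M[R]_(1 + (2 + 2), 2 + 2 + 1) := block_mx 0 1%:M 1%:M 0.
pose N (t : (2 + 2).-tuple R) := Nform (p := 2) (q := 2) (row_of_tuple t).
have pos t : cone (lift_hull L s `&` @Hpq R 2 2) (affine_point (row_of_tuple t)) -> 0 < N t.
  by move=> /cone_HpqP[_]; rewrite /N /Nform oppr_gt0.
rewrite /volume.
rewrite (eq_integral (fun t => (Num.sqrt (N t ^- 5))%:E)); last first.
  by move=> t /set_mem/pos tpos; rewrite volume_densityE.
have SwB : Sw *m B \in unitmx.
  pose Sw' : 'M[R]_(2 + 2 + 1, 1 + (2 + 2)) := block_mx 0 1%:M 1%:M 0.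
  have SS : Sw *m Sw' = 1%:M.
    by rewrite mulmx_block !mulmx0 !mul0mx !mulmx1 !add0r !addr0 -scalar_mx_block.
  have [Swu _] := mulmx1_unit (SS : (Sw : 'M[R]_5) *m (Sw' : 'M[R]_5) = 1%:M).
  by rewrite unitmx_mul Swu unitmx_inv.
apply: (integral_cone_lt_pinfty SwB measurable_five_cycle_region
  lebesgue_five_cycle_region pos).
move=> t r /cone_HpqP[tc _] r0 rN k.
have [c [xE _ cs]] := lift_hull_cone sw tc.
pose x := affine_point (row_of_tuple t) : V.
pose u : V := x *m B.
have uE i : u 0 i = l^-1 * c 0 (f i).
  have -> : u = \row_i (l^-1 * c 0 (f i)); last by rewrite mxE.
  apply: (can_inj (mulmxK vu)); rewrite /u mulmxKV// /x xE !mul_frame_mx.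
  rewrite (reindex_inj fi); apply: eq_bigr => j _.
  by rewrite mxE vE scalerA mulrAC mulVf ?mul1r// gt_eqF.
have u0 i j : 0 <= u 0 i * u 0 j.
  rewrite !uE mulrACA; apply: mulr_ge0; first by rewrite mulr_ge0// invr_ge0 ltW.
  by case: cs => cs; [apply: mulr_ge0|apply: mulr_le0]; exact: cs.
have tnE i : tnth (linT (Sw *m B) (ctuple r (map_tuple (fun x => r * x) t))) i = r * u 0 i.
  rewrite /linT trow_thead tnth_mktuple mulmxA.
  have -> : row_mx (thead (ctuple r (map_tuple (fun x => r * x) t)))%:M
      (trow [tuple of behead (ctuple r (map_tuple (fun x => r * x) t))]) *m Sw = r *: x.
    rewrite (mul_row_block _ _ 0 1%:M 1%:M 0) !mulmx0 !mulmx1 add0r addr0.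
    rewrite /x /affine_point scale_row_mx; congr row_mx; last by rewrite scalemx1 theadE.
    by apply/rowP => j; rewrite !mxE tnth_behead_lift tnthS tnth_map.
  by rewrite -scalemxAl mxE.
(* In the barycentric coordinates [u] of [x], the normalisation b(v_k, v_(k+1)) <= -1 gives u_k
   u_(k+1) <= N(t); multiplying by r^2 yields a bound by r^2 N(t) <= 1. *)
rewrite !tnE mulrACA -expr2 ger0_norm; last by rewrite mulr_ge0 ?sqr_ge0.
apply: le_trans rN; rewrite ler_wpM2l ?sqr_ge0// /N /Nform -/x.
have xu : x = u *m frame_mx v by rewrite /u mulmxKV.
rewrite [in leRHS]xu; apply: le_trans (form_frame_mx_ge k (k + 1) vneg u0).
by rewrite ler_peMr// lerNr.
Qed.

End ideal_simplices_H22.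

Theorem mainTheorem2 (R : realType) :
  ((exists Lambda : set (proj_space R (2 + 2 + 1)),
      simplex 2 2 Lambda /\ simplex_volume 2 2 Lambda = +oo%E) /\
   (forall Lambda : set (proj_space R (2 + 2 + 1)),
      simplex 2 2 Lambda -> simplex_volume 2 2 Lambda = +oo%E ->
      ~ ideal 2 2 Lambda)) /\
  (forall p q : nat, (3 <= p)%N -> (1 <= q)%N ->
    (exists Lambda : set (proj_space R (p + q + 1)),
       [/\ simplex p q Lambda, ideal p q Lambda &
           simplex_volume p q Lambda = +oo%E]) /\
    (exists Lambda : set (proj_space R (p + q + 1)),
       [/\ simplex p q Lambda, ~ ideal p q Lambda &
           simplex_volume p q Lambda = +oo%E])).
Proof.
split; last first.
  move=> p q p3 q1; split; first exact: exists_ideal_simplex_pinfty.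
  by apply: exists_non_ideal_simplex_pinfty => //; exact: leq_trans p3.
split.
  have [//|//|L [sL _ vL]] := @exists_non_ideal_simplex_pinfty R 2 2.
  by exists L.
move=> L sL vL iL; have := ideal_simplex_volume_lt_pinfty sL iL.
by rewrite vL ltxx.
Qed.
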